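(* Let $\Phi_h=e^{b_shB_s}e^{a_shA}\cdots e^{b_1hB_1}e^{a_1hA}$ be a generalized modified splitting method with $a_j,b_j\in\mathbb R$, $\sum_{j=1}^sa_j=1$, expanded as a decorated multi-index series $\Phi_h=e^{hA}B_\Lambda(\alpha)$, where $\alpha(\mu,\lambda)=\prod_{i=1}^kb_{\lambda_i}c_{\lambda_i}^{\mu_i}$ for $\mu\in\mathbb N^k,\lambda\in\Lambda_k$ and $c_m=\sum_{j=1}^ma_j$. Let $B_j=B+C_j=\frac1hB(\beta_j)$, $j=1,\dots,s$, where $C_j$ is an arbitrary linear combination of nested commutators of $A$ and $B$ (so $\beta_j$ is an infinitesimal character with $\beta_j((0))=1$). Then $\Phi_h$ can be expanded as a multi-index series $$\Phi_h=e^{hA}B(\beta\star\alpha),\qquad(\beta\star\alpha)(\mu):=\sum_{(\mu)}\ \sum^!_{\lambda\in\Lambda_{\#\mu_{(2)}}}\beta_\lambda(\mu_{(1)})\,\alpha(\mu_{(2)},\lambda)\quad(\mu\in\mathbb N^\infty),$$ where $\Delta_\triangleright(\mu)=\sum_{(\mu)}\mu_{(1)}\otimes\mu_{(2)}$ and $\beta_\lambda(\eta_1\odot\cdots\odot\eta_k):=\beta_{\lambda_1}(\eta_1)\cdots\beta_{\lambda_k}(\eta_k)$.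
   Context: $\mathbb N$ contains $0$. $A,B$ are linear operators; operator exponentials and infinite sums are read as formal power series in the time step $h$ (e.g. $A,B$ are elements of a unital associative real algebra $\mathcal A$ and identities hold in $\mathcal A[[h]]$). $[X,Y]=XY-YX$; $\mathrm{ad}_X^0(Y)=Y$, $\mathrm{ad}_X^j(Y)=[X,\mathrm{ad}_X^{j-1}(Y)]$. In $C_j$ a nested commutator with $m\ge2$ letters is multiplied by $h^{m-1}$. Multi-indices: finite tuples $\mu=(\mu_1,\dots,\mu_k)\in\mathbb N^k$, $k\ge0$ (empty one: $\mathbf 1$); the set of all is $\mathbb N^\infty$, spanning the real vector space $\mathcal M$; $\#\mu=k$, $\mu!=\prod_j\mu_j!$, $|\mu|=k+\sum_j\mu_j$. $\mathbb F(\mu)=h^{|\mu|}\mathrm{ad}_{-A}^{\mu_k}(B)\cdots\mathrm{ad}_{-A}^{\mu_1}(B)$, $\mathbb F(\mathbf 1)=\mathrm{id}$; multi-index series $B(\alpha)=\sum_{\mu\in\mathbb N^\infty}\frac{\alpha(\mu)}{\mu!}\mathbb F(\mu)$. Decorated version: $\Lambda_k=\{\lambda\in\mathbb N^k:1\le\lambda_1\le\cdots\le\lambda_k\le s\}$; $\mathbb F(\mu,\lambda)=h^{|\mu|}\mathrm{ad}_{-A}^{\mu_k}(B_{\lambda_k})\cdots\mathrm{ad}_{-A}^{\mu_1}(B_{\lambda_1})$ for $\mu\in\mathbb N^k,\lambda\in\Lambda_k$; $\sum^!$ weights the term with decoration $\lambda$ by $\frac1{q_1!\cdots q_s!}$,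 $q_i$ being the number of occurrences of $i$ in $\lambda$; $B_\Lambda(\alpha)=\sum^!_{(\mu,\lambda)}\frac{\alpha(\mu,\lambda)}{\mu!}\mathbb F(\mu,\lambda)$, the sum over all $k\ge 0$, $\mu\in\mathbb N^k$, $\lambda\in\Lambda_k$. (Convention $0^0=1$.) An infinitesimal character is a map $\beta:\mathbb N^\infty\to\mathbb R$ (extended linearly) with $\beta(\mathbf 1)=0$ and $\beta(\mu\sqcup\!\sqcup\eta)=0$ for all non-empty $\mu,\eta$, where $\sqcup\!\sqcup$ is the shuffle product of tuples regarded as words. Coproduct $\Delta_\triangleright:\mathcal M\to T(\mathcal M)\otimes\mathcal M$, with $T(\mathcal M)$ the tensor algebra (product $\odot$, unit $\mathbf 1_T$): $$\Delta_\triangleright(\mu)=\sum_{\pi\in P(\mu),\ p_i\in\mathbb N^{\#\pi_i}}\binom{\pi_1}{p_1}\cdots\binom{\pi_k}{p_k}(\pi_1\setminus p_1)\odot\cdots\odot(\pi_k\setminus p_k)\otimes\Big(\sum_jp_{1,j},\dots,\sum_jp_{k,j}\Big),$$ where $P(\mu)$ is the set of all $(\pi_1,\dots,\pi_k)$ (with varying $k$) of non-empty multi-indices whose concatenation is $\mu$; $\Delta_\triangleright(\mathbf 1)=\mathbf 1_T\otimes\mathbf 1$; $\binom{\pi}{p}=\prod_i\binom{\pi_i}{p_i}$; $\pi\setminus p$ is the entrywise difference if all its entries are $\ge0$ and $0\in\mathcal M$ otherwise. *)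

(* Defs.v *)
From HB Require Import structures.
From mathcomp Require Import all_boot all_order all_algebra.
From mathcomp Require Import boolp classical_sets fsbigop reals.
Set Implicit Arguments.
Unset Strict Implicit.
Unset Printing Implicit Defensive.
Import Order.TTheory GRing.Theory Num.Theory.
Local Open Scope ring_scope.

(** * The algebra A[[h]] over a (non-commutative) algebra A *)

Record fps (T : Type) := Fps { fcoef : nat -> T }.
Coercion fcoef : fps >-> Funclass.

Lemma fcoefK (T : Type) : cancel (@fcoef T) (@Fps T).
Proof. by case. Qed.

Lemma fpsP (T : Type) (f g : fps T) : (forall n, f n = g n) -> f = g.
Proof. by case: f => f; case: g => g /= e; congr Fps; apply: funext. Qed.

HB.instance Definition _ (T : Type) := gen_eqMixin (fps T).
HB.instance Definition _ (T : Type) := gen_choiceMixin (fps T).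

Section FpsRing.
Variables (R : nzRingType) (A : algType R).
Implicit Types f g : fps A.

Definition fps_zero : fps A := Fps (fun=> 0).
Definition fps_opp f : fps A := Fps (fun n => - f n).
Definition fps_add f g : fps A := Fps (fun n => f n + g n).
Definition fpsC (x : A) : fps A := Fps (fun n => if n is 0%N then x else 0).
Definition fps_mul f g : fps A :=
  Fps (fun n => \sum_(i < n.+1) f i * g (n - i)%N).
Definition fps_scale (r : R) f : fps A := Fps (fun n => r *: f n).

Fact fps_addA : associative fps_add.
Proof. by move=> f g k; apply: fpsP => n /=; rewrite addrA. Qed.
Fact fps_addC : commutative fps_add.
Proof. by move=> f g; apply: fpsP => n /=; rewrite addrC. Qed.
Fact fps_add0 : left_id fps_zero fps_add.
Proof. by move=> f; apply: fpsP => n /=; rewrite add0r. Qed.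
Fact fps_addN : left_inverse fps_zero fps_opp fps_add.
Proof. by move=> f; apply: fpsP => n /=; rewrite addNr. Qed.

HB.instance Definition _ :=
  GRing.isZmodule.Build (fps A) fps_addA fps_addC fps_add0 fps_addN.

Lemma fps_mul_rev f g n :
  fps_mul f g n = \sum_(i < n.+1) f (n - i)%N * g i.
Proof.
rewrite /= (reindex_inj rev_ord_inj) /=; apply: eq_bigr => i _.
by rewrite subSS subKn // -ltnS.
Qed.

Fact fps_mulA : associative fps_mul.
Proof.
move=> p q r; apply: fpsP => i; rewrite [RHS]fps_mul_rev /=.
pose coef3 j k := p j * (q (i - j - k)%N * r k).
transitivity (\sum_(j < i.+1) \sum_(k < i.+1 | (k <= i - j)%N) coef3 j k).
  apply: eq_bigr => /= j _; rewrite -[\sum_(_ < _) _]/(fps_mul q r (i - j)%N).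
  rewrite fps_mul_rev big_distrr /=.
  by rewrite (big_ord_narrow_leq (leq_subr _ _)).
rewrite (exchange_big_dep predT) //=; apply: eq_bigr => k _.
transitivity (\sum_(j < i.+1 | (j <= i - k)%N) coef3 j k).
  apply: eq_bigl => j; rewrite -ltnS -(ltnS j) -!subSn ?leq_ord //.
  by rewrite -subn_gt0 -(subn_gt0 j) -!subnDA addnC.
rewrite (big_ord_narrow_leq (leq_subr _ _)) big_distrl /=.
by apply: eq_bigr => j _; rewrite /coef3 -!subnDA addnC mulrA.
Qed.

Fact fps_mul1l : left_id (fpsC 1) fps_mul.
Proof.
move=> f; apply: fpsP => n /=; rewrite big_ord_recl /= mul1r subn0.
by rewrite big1 ?addr0 // => i _; rewrite mul0r.
Qed.
Fact fps_mul1r : right_id (fpsC 1) fps_mul.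
Proof.
move=> f; apply: fpsP => n; rewrite fps_mul_rev big_ord_recl /= mulr1 subn0.
by rewrite big1 ?addr0 // => i _; rewrite mulr0.
Qed.
Fact fps_mulDl : left_distributive fps_mul fps_add.
Proof.
move=> f g k; apply: fpsP => n /=; rewrite -big_split /=.
by apply: eq_bigr => i _; rewrite mulrDl.
Qed.
Fact fps_mulDr : right_distributive fps_mul fps_add.
Proof.
move=> f g k; apply: fpsP => n /=; rewrite -big_split /=.
by apply: eq_bigr => i _; rewrite mulrDr.
Qed.
Fact fps_1_neq0 : fpsC 1 != fps_zero.
Proof.
apply/eqP => /(congr1 (fun f : fps A => f 0%N)) /= /eqP.
by rewrite oner_eq0.
Qed.

HB.instance Definition _ := GRing.Zmodule_isNzRing.Build (fps A)
  fps_mulA fps_mul1l fps_mul1r fps_mulDl fps_mulDr fps_1_neq0.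

Fact fps_scaleA r s f : fps_scale r (fps_scale s f) = fps_scale (r * s) f.
Proof. by apply: fpsP => n /=; rewrite scalerA. Qed.
Fact fps_scale1 : left_id 1 fps_scale.
Proof. by move=> f; apply: fpsP => n /=; rewrite scale1r. Qed.
Fact fps_scaleDr : right_distributive fps_scale +%R.
Proof. by move=> r f g; apply: fpsP => n /=; rewrite scalerDr. Qed.
Fact fps_scaleDl f : {morph fps_scale^~ f : r s / r + s}.
Proof. by move=> r s; apply: fpsP => n /=; rewrite scalerDl. Qed.

HB.instance Definition _ := GRing.Zmodule_isLmodule.Build R (fps A)
  fps_scaleA fps_scale1 fps_scaleDr fps_scaleDl.

Fact fps_scaleAl (r : R) (f g : fps A) : r *: (f * g) = r *: f * g.
Proof.
apply: fpsP => n /=; rewrite scaler_sumr.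
by apply: eq_bigr => i _; rewrite scalerAl.
Qed.
HB.instance Definition _ := GRing.Lmodule_isLalgebra.Build R (fps A) fps_scaleAl.

Fact fps_scaleAr (r : R) (f g : fps A) : r *: (f * g) = f * (r *: g).
Proof.
apply: fpsP => n /=; rewrite scaler_sumr.
by apply: eq_bigr => i _; rewrite scalerAr.
Qed.
HB.instance Definition _ := GRing.Lalgebra_isAlgebra.Build R (fps A) fps_scaleAr.

End FpsRing.

Section Series.
Variables (R : realType) (A : algType R).

(** The time step h, as a (central) element of A[[h]]. *)
Definition fpsX : fps A := Fps (fun n => if n == 1%N then 1 else 0).

(** The sum of a family of power series, coefficient by coefficient.  It is
    meaningful for families of which only finitely many members contribute to
    each power of h: the value of [\sum_(i \in _) _] on an infinitely supported
    family is 0 by convention.  All the families below satisfy this. *)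
Definition fps_sum (I : choiceType) (f : I -> fps A) : fps A :=
  Fps (fun n => \sum_(i \in [set: I]) f i n).

(** Meaningful for X without constant term. *)
Definition fps_exp (X : fps A) : fps A :=
  fps_sum (fun n : nat => (n`!%:R)^-1 *: X ^+ n).

End Series.

Notation "''h'" := (fpsX _) : ring_scope.

Definition ad (T : nzRingType) (X Y : T) : T := X * Y - Y * X.

(** * Nested commutators of the letters A and B *)

Inductive bracket :=
  | LetterA
  | LetterB
  | Bracket of bracket & bracket.

HB.instance Definition _ := gen_eqMixin bracket.
HB.instance Definition _ := gen_choiceMixin bracket.

Fixpoint nletters (t : bracket) : nat :=
  if t is Bracket t1 t2 then nletters t1 + nletters t2 else 1.

Fixpoint bracket_eval (T : nzRingType) (A B : T) (t : bracket) : T :=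
  match t with
  | LetterA => A
  | LetterB => B
  | Bracket t1 t2 => ad (bracket_eval A B t1) (bracket_eval A B t2)
  end.

(** Linear combinations of commutators with m >= 2 letters, each multiplied by
    h^(m-1).  As only finitely many brackets have a given number of letters,
    the coefficients need not be finitely supported. *)
Definition commutator_comb (R : realType) (A : algType R) (a b : A)
    (C : fps A) : Prop :=
  exists r : bracket -> R,
    C = fps_sum (fun t => if (2 <= nletters t)%N then
          r t *: ('h ^+ (nletters t).-1 * fpsC (bracket_eval a b t)) else 0).

(** * Multi-indices *)

Definition mindex := seq nat.

Definition mfact (mu : mindex) : nat := \prod_(m <- mu) m`!.

Definition weight (mu : mindex) : nat := size mu + sumn mu.

(** The shuffle product, as the list (with multiplicities) of its terms. *)
Fixpoint shuffle (mu : mindex) : mindex -> seq mindex :=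
  fix shuffle_mu (eta : mindex) : seq mindex :=
    match mu, eta with
    | [::], _ => [:: eta]
    | _, [::] => [:: mu]
    | m :: mu', n :: eta' =>
        map (cons m) (shuffle mu' eta) ++ map (cons n) (shuffle_mu eta')
    end.

Definition infinitesimal_character (R : realType) (beta : mindex -> R) : Prop :=
  beta [::] = 0 /\
  forall mu eta : mindex, mu != [::] -> eta != [::] ->
    \sum_(w <- shuffle mu eta) beta w = 0.

(** ** The coproduct *)

(** A finite formal linear combination of elements of X. *)
Definition formal_sum (R X : Type) := seq (R * X).

(** The set P(mu), without repetition (see [mem_splittings] and
    [splittings_uniq]). *)
Fixpoint splittings (mu : mindex) : seq (seq mindex) :=
  if mu is m :: mu' then
    [seq [:: m] :: pi | pi <- splittings mu'] ++
    [seq (m :: head [::] pi) :: behead pi | pi <- splittings mu' & pi != [::]]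
  else [:: [::]].

Lemma mem_splittings mu pi :
  (pi \in splittings mu) = (flatten pi == mu) && all (fun w => w != [::]) pi.
Proof.
elim: mu pi => [|m mu IH] pi /=.
  rewrite inE; case: pi => [|w pi] //=; case: w => [|n w] //=.
  by rewrite andbF.
rewrite mem_cat; apply/orP/andP.
  case=> /mapP[rho].
    by rewrite IH => /andP[/eqP <- arho] ->; rewrite /= eqxx.
  rewrite mem_filter IH => /andP[rho0 /andP[/eqP <- arho]] ->.
  by case: rho rho0 arho => [|w rho] //= _ /andP[_ ->]; rewrite eqxx.
case: pi => [|[|n [|n' w]] pi] //= [] // /eqP[-> e] ap.
  by left; apply/mapP; exists pi; rewrite // IH e eqxx.
right; apply/mapP; exists ((n' :: w) :: pi) => //.
by rewrite mem_filter IH /= e eqxx.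
Qed.

Lemma splittings_uniq mu : uniq (splittings mu).
Proof.
elim: mu => [|m mu IH] //=; rewrite cat_uniq; apply/and3P; split.
- by rewrite map_inj_uniq // => x y [].
- apply/hasPn => _ /mapP[rho + ->]; rewrite mem_filter mem_splittings.
  case: rho => [|w rho] //= /andP[_ /andP[w0 _]].
  by apply/mapP => -[x _ [e _]]; move: w0; rewrite e.
rewrite map_inj_in_uniq ?filter_uniq // => x y.
by rewrite !mem_filter; case: x => [|v x]; case: y => [|w y] //= _ _ [-> ->].
Qed.

(** All the sequences whose i-th entry belongs to the i-th list. *)
Definition cartesian (T : Type) (ss : seq (seq T)) : seq (seq T) :=
  foldr (fun s ts => [seq x :: t | x <- s, t <- ts]) [:: [::]] ss.

(** The multi-indices of the same length as pi and entrywise at most pi. *)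
Definition below (pi : mindex) : seq mindex :=
  cartesian [seq iota 0 m.+1 | m <- pi].

Definition mbinom (pi p : mindex) : nat := \prod_(x <- zip pi p) 'C(x.1, x.2).

Definition mdiff (pi p : mindex) : mindex := [seq (x.1 - x.2)%N | x <- zip pi p].

(** The coproduct of mu.  A tensor (eta_1 (.) ... (.) eta_k) (x) nu of basis
    elements is the pair of the list of the eta_i and of nu.  The tuples p with
    some p_i not entrywise at most pi_i are omitted, their terms being 0. *)
Definition coprod (R : realType) (mu : mindex) :
    formal_sum R (seq mindex * mindex) :=
  [seq ((\prod_(x <- zip pi p) mbinom x.1 x.2)%:R,
        ([seq mdiff x.1 x.2 | x <- zip pi p], map sumn p))
  | pi <- splittings mu, p <- cartesian (map below pi)].

(** * Multi-index series *)

(** The operator F(mu), in which the last entry of mu gives the leftmost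
    factor. *)
Definition elem_diff (R : realType) (A : algType R) (a b : A) (mu : mindex) :
    fps A :=
  'h ^+ weight mu * \prod_(m <- rev mu) iter m (ad (- fpsC a)) (fpsC b).

Definition mseries (R : realType) (A : algType R) (a b : A)
    (alpha : mindex -> R) : fps A :=
  fps_sum (fun mu : mindex =>
    (alpha mu / (mfact mu)%:R) *: elem_diff a b mu).

(** ** Decorated series

    Decorations take their values in 'I_s, that is {0, ..., s - 1}. *)

Definition dec_sorted (s : nat) (lam : seq 'I_s) : bool :=
  sorted leq (map val lam).

Definition dec_mult (s : nat) (lam : seq 'I_s) : nat :=
  \prod_(i < s) (count_mem i lam)`!.

(** The weighted sum over Lambda_k. *)
Definition dec_sum (R : realType) (V : lmodType R) (s k : nat)
    (f : seq 'I_s -> V) : V :=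
  \sum_(lam : k.-tuple 'I_s | dec_sorted lam)
     (dec_mult lam)%:R^-1 *: f lam.

Definition dec_elem_diff (R : realType) (A : algType R) (s : nat) (a : A)
    (B : 'I_s -> fps A) (mu : mindex) (lam : seq 'I_s) : fps A :=
  'h ^+ weight mu *
    \prod_(x <- rev (zip mu lam)) iter x.1 (ad (- fpsC a)) (B x.2).

Definition dec_mseries (R : realType) (A : algType R) (s : nat) (a : A)
    (B : 'I_s -> fps A) (alpha : mindex -> seq 'I_s -> R) : fps A :=
  fps_sum (fun mu : mindex =>
    dec_sum (size mu) (fun lam =>
      (alpha mu lam / (mfact mu)%:R) *: dec_elem_diff a B mu lam)).

(** ** Substitution *)

(** beta_lambda on the tensor eta_1 (.) ... (.) eta_k. *)
Definition dec_tensor (R : realType) (s : nat) (beta : 'I_s -> mindex -> R)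
    (lam : seq 'I_s) (eta : seq mindex) : R :=
  \prod_(x <- zip lam eta) beta x.1 x.2.

(** The product beta * alpha.  In a term [t] of the coproduct, [t.1] is the
    scalar coefficient, [t.2.1] is mu_(1) and [t.2.2] is mu_(2). *)
Definition mstar (R : realType) (s : nat) (beta : 'I_s -> mindex -> R)
    (alpha : mindex -> seq 'I_s -> R) (mu : mindex) : R :=
  \sum_(t <- coprod R mu)
    t.1 * dec_sum (size t.2.2)
      (fun lam => dec_tensor beta lam t.2.1 * alpha t.2.2 lam : R^o).

(** * Splitting methods *)

Definition split_node (R : realType) (s : nat) (a : 'I_s -> R) (m : 'I_s) : R :=
  \sum_(j < s | (j <= m)%N) a j.

Definition split_coef (R : realType) (s : nat) (a b : 'I_s -> R)
    (mu : mindex) (lam : seq 'I_s) : R :=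
  \prod_(x <- zip mu lam) (b x.2 * split_node a x.2 ^+ x.1).

(** The factors with larger indices stand on the left. *)
Definition split_method (R : realType) (A : algType R) (s : nat)
    (a b : 'I_s -> R) (opA : A) (opB : 'I_s -> fps A) : fps A :=
  \prod_(j <- rev (enum 'I_s))
     (fps_exp (b j *: ('h * opB j)) * fps_exp (a j *: ('h * fpsC opA))).

(* Main.v *)
(** Put X = hA.  Moving every exponential of A to the left turns the method into
    e^X e^{y_s} ... e^{y_1}, where y_j is b_j e^{-c_j X} (h B_j) e^{c_j X}, that
    is, the sum over m of b_j c_j^m / m! ad_{-X}^m (h B_j).  Expanding the product
    of exponentials over sorted words in the y_j gives the decorated series.

    Multi-index series are word series: sums over words of coefficients times
    products of the generators x_m = ad_{-X}^m (h B).  Products of series are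
    convolutions of coefficients, and conjugation by e^{cX} sends x_m to the sum
    of the c^p / p! x_{m+p}, so each y_j is again a word series, whose
    coefficients carry the factors binom(pi, p) of the coproduct; a product of
    the y_j distributes mu over the splittings of mu.

    For the characters of the B_j, brackets are handled recursively: the bracket
    with A is the derivation ad_{-X} and the bracket of two series is a convolution
    commutator; both preserve infinitesimal characters. *)

Require Import Defs.
From mathcomp Require Import all_boot all_order all_algebra.
From mathcomp Require Import boolp classical_sets fsbigop reals.
From mathcomp Require Import ring.
Set Implicit Arguments.
Unset Strict Implicit.
Unset Printing Implicit Defensive.
Import Order.TTheory GRing.Theory Num.Theory.
Local Open Scope ring_scope.

(** * Summable families of power series *)

Section Summation.
Variables (R : realType) (A : algType R).
Implicit Types (f g : fps A) (I J : choiceType).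

Lemma fcoefD f g n : (f + g) n = f n + g n. Proof. by []. Qed.
Lemma fcoefZ (r : R) f n : (r *: f) n = r *: f n. Proof. by []. Qed.
Lemma fcoefM f g n : (f * g) n = \sum_(i < n.+1) f i * g (n - i)%N.
Proof. by []. Qed.

Lemma fcoef_sum (I : Type) (s : seq I) (P : pred I) (F : I -> fps A) n :
  (\sum_(i <- s | P i) F i) n = \sum_(i <- s | P i) F i n.
Proof. exact: (big_morph (fun f : fps A => f n) (fun f g => fcoefD f g n)). Qed.

Lemma eq_fcoefM n f f' g g' :
  (forall m, (m <= n)%N -> f m = f' m) -> (forall m, (m <= n)%N -> g m = g' m) ->
  (f * g) n = (f' * g') n.
Proof.
move=> ef eg; rewrite !fcoefM; apply: eq_bigr => i _.
by rewrite ef -1?ltnS // eg // leq_subr.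
Qed.

Definition vanish n f := forall m, (m < n)%N -> f m = 0.

Lemma vanishM n m f g : vanish n f -> vanish m g -> vanish (n + m) (f * g).
Proof.
move=> vf vg k ltk; rewrite fcoefM big1 // => i _.
have [lt_in | le_ni] := ltnP i n; first by rewrite vf ?mul0r.
rewrite vg ?mulr0 // ltn_subLR; last by rewrite -ltnS.
by rewrite (leq_trans ltk) // leq_add2r.
Qed.

Lemma vanishMl n f g : vanish n f -> vanish n (g * f).
Proof. by move=> vf; rewrite -[n]add0n; apply: vanishM. Qed.

Lemma vanishMr n f g : vanish n f -> vanish n (f * g).
Proof. by move=> vf; rewrite -[n]addn0; apply: vanishM. Qed.

Lemma vanishZ n (r : R) f : vanish n f -> vanish n (r *: f).
Proof. by move=> vf m /vf e; rewrite fcoefZ e scaler0. Qed.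

Lemma vanishX n f : vanish 1 f -> vanish n (f ^+ n).
Proof.
by move=> vf; elim: n => [|n IH] //; rewrite exprS -add1n; apply: vanishM.
Qed.

Lemma vanish_leq m n f : (m <= n)%N -> vanish n f -> vanish m f.
Proof. by move=> le_mn vf k lt_km; rewrite vf // (leq_trans lt_km). Qed.

(** [fps_sum] is 0 by convention when infinitely many members contribute to a coefficient; a finite
    list covering the support in degree [n] rules this default out. *)
Lemma fps_sum_seq (I : choiceType) (F : I -> fps A) n (s : seq I) :
  uniq s -> (forall i, i \notin s -> F i n = 0) ->
  fps_sum F n = \sum_(i <- s) F i n.
Proof.
move=> us Fs; rewrite /fps_sum /= (fsbigE s) //.
- by apply: eq_bigl => i; rewrite in_setT.
- by move=> i _; apply: Fs.
Qed.

Lemma eq_fps_sum (I : choiceType) (F G : I -> fps A) :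
  F =1 G -> fps_sum F = fps_sum G.
Proof. by move=> /funext ->. Qed.

Lemma fps_sum_single (I : choiceType) (i0 : I) (F : I -> fps A) :
  (forall i, i != i0 -> F i = 0) -> fps_sum F = F i0.
Proof.
move=> F0; apply: fpsP => n; rewrite (@fps_sum_seq _ _ _ [:: i0]) ?big_seq1 //.
by move=> i; rewrite inE => /F0 ->.
Qed.

(** Local finiteness: modulo h^(n+1) all but finitely many members vanish. Products need this
    control of all degrees up to [n] at once. *)
Definition summable (I : choiceType) (F : I -> fps A) :=
  forall n, exists2 s : seq I, uniq s & forall i, i \notin s -> vanish n.+1 (F i).

Lemma fps_sum_trunc (I : choiceType) (F : I -> fps A) n (s : seq I) m :
    uniq s -> (forall i, i \notin s -> vanish n.+1 (F i)) -> (m <= n)%N ->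
  fps_sum F m = (\sum_(i <- s) F i) m.
Proof.
by move=> us Fs le_mn; rewrite fcoef_sum (fps_sum_seq us) // => i /Fs; apply.
Qed.

Lemma summableM (I J : choiceType) (F : I -> fps A) (G : J -> fps A) :
  summable F -> summable G -> summable (fun p : I * J => F p.1 * G p.2).
Proof.
move=> sF sG n; have [s us Fs] := sF n; have [t ut Gt] := sG n.
exists [seq (i, j) | i <- s, j <- t].
  by apply: allpairs_uniq => // -[? ?] [? ?] _ _ [-> ->].
move=> [i j] /= ijP; have [iS | iS] := boolP (i \in s).
  apply/vanishMl/Gt; apply: contra ijP => jT.
  by apply/allpairsP; exists (i, j).
exact/vanishMr/Fs.
Qed.

(** The n-th coefficient of a product involves only degrees up to [n], so both sums may be truncated
    and finite distributivity applies. *)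
Lemma fps_sumM (I J : choiceType) (F : I -> fps A) (G : J -> fps A) :
  summable F -> summable G ->
  fps_sum F * fps_sum G = fps_sum (fun p : I * J => F p.1 * G p.2).
Proof.
move=> sF sG; apply: fpsP => n.
have [s us Fs] := sF n; have [t ut Gt] := sG n.
rewrite (eq_fcoefM (fun m => fps_sum_trunc us Fs (m := m))
                   (fun m => fps_sum_trunc ut Gt (m := m))).
rewrite (@fps_sum_seq _ _ _ [seq (i, j) | i <- s, j <- t]); first last.
- move=> [i j] ijP; have [iS | iS] := boolP (i \in s).
    rewrite (vanishMl _ (Gt j _)) ?ltnSn //; apply: contra ijP => jT.
    by apply/allpairsP; exists (i, j).
  by rewrite (vanishMr _ (Fs i _)).
- by apply: allpairs_uniq => // -[? ?] [? ?] _ _ [-> ->].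
by rewrite big_allpairs_dep big_distrlr fcoef_sum; apply: eq_bigr => i _; rewrite fcoef_sum.
Qed.

Lemma fps_sumMl (I : choiceType) (F : I -> fps A) g :
  summable F -> g * fps_sum F = fps_sum (fun i => g * F i).
Proof.
move=> sF; apply: fpsP => n; have [s us Fs] := sF n.
rewrite (eq_fcoefM (f' := g) _ (fun m => fps_sum_trunc us Fs (m := m))) //.
rewrite mulr_sumr (fps_sum_trunc (n := n) us) // => i /Fs; exact: vanishMl.
Qed.

Lemma fps_sumMr (I : choiceType) (F : I -> fps A) g :
  summable F -> fps_sum F * g = fps_sum (fun i => F i * g).
Proof.
move=> sF; apply: fpsP => n; have [s us Fs] := sF n.
rewrite (eq_fcoefM (g' := g) (fun m => fps_sum_trunc us Fs (m := m))) //.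
rewrite mulr_suml (fps_sum_trunc (n := n) us) // => i /Fs; exact: vanishMr.
Qed.

Lemma fps_sumZ (I : choiceType) (F : I -> fps A) (r : R) :
  summable F -> r *: fps_sum F = fps_sum (fun i => r *: F i).
Proof.
move=> sF; rewrite -[fps_sum F]mul1r scalerAl fps_sumMl //.
by apply: eq_fps_sum => i; rewrite -scalerAl mul1r.
Qed.

Lemma summableMl (I : choiceType) (F : I -> fps A) (g : I -> fps A) :
  summable F -> summable (fun i => g i * F i).
Proof.
by move=> sF n; have [s us Fs] := sF n; exists s => // i /Fs; exact: vanishMl.
Qed.

Lemma summableMr (I : choiceType) (F : I -> fps A) (g : I -> fps A) :
  summable F -> summable (fun i => F i * g i).
Proof.
by move=> sF n; have [s us Fs] := sF n; exists s => // i /Fs; exact: vanishMr.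
Qed.

Lemma summableZ (I : choiceType) (F : I -> fps A) (u : I -> R) :
  summable F -> summable (fun i => u i *: F i).
Proof.
by move=> sF n; have [s us Fs] := sF n; exists s => // i /Fs; exact: vanishZ.
Qed.

(** Regroups a summable family along a map [p] whose finite fibres are listed by [fib]. In each
    degree only a finite list counts, so this is an exchange of two finite sums. *)
Lemma fps_sum_partition (I J : choiceType) (F : I -> fps A) (p : I -> J)
    (fib : J -> seq I) :
  (forall j, uniq (fib j)) -> (forall i j, (i \in fib j) = (p i == j)) ->
  summable F -> fps_sum F = fps_sum (fun j => \sum_(i <- fib j) F i).
Proof.
move=> ufib fibP sF; apply: fpsP => n; have [s us Fs] := sF n.
have F0 i : i \notin s -> F i n = 0 by move=> /Fs; apply.
have sub j : \sum_(i <- fib j) F i n = \sum_(i <- s | p i == j) F i n.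
  rewrite (bigID (fun i => i \in s)) /= [X in _ + X]big1 ?addr0; last first.
    by move=> i; apply: F0.
  rewrite -[LHS]big_filter -[RHS]big_filter; apply: perm_big.
  apply: uniq_perm; rewrite ?filter_uniq // => i.
  by rewrite !mem_filter fibP andbC.
rewrite (fps_sum_seq us) // (@fps_sum_seq _ _ _ (undup (map p s))) ?undup_uniq //.
  under [RHS]eq_bigr => j _ do rewrite fcoef_sum sub.
  rewrite (exchange_big_dep predT) //= big_seq [RHS]big_seq.
  apply: eq_bigr => i iS; rewrite -big_filter.
  have -> : [seq j <- undup (map p s) | p i == j] = [:: p i].
    apply: perm_small_eq => //; apply: uniq_perm; rewrite ?filter_uniq ?undup_uniq //.
    move=> j; rewrite mem_filter inE mem_undup eq_sym.
    by apply: andb_idr => /eqP ->; apply: map_f.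
  by rewrite big_seq1.
move=> j; rewrite mem_undup fcoef_sum sub => jP; rewrite big_seq_cond big1 // => i.
by case/andP=> iS /eqP e; case/negP: jP; rewrite -e map_f.
Qed.

End Summation.

(** * Exponentials and conjugation by them *)

Section Exponential.
Variables (R : realType) (A : algType R).
Implicit Types (X Y Z : fps A) (c d : R).

Lemma summableX (u : nat -> R) X : vanish 1 X -> summable (fun k => u k *: X ^+ k).
Proof.
move=> vX; apply: summableZ => n; exists (iota 0 n.+1); first exact: iota_uniq.
move=> k; rewrite mem_iota /= add0n -leqNgt => le_nk.
exact/(vanish_leq le_nk)/vanishX.
Qed.

Lemma fps_expZ c X : fps_exp (c *: X) = fps_sum (fun k => (c ^+ k / k`!%:R) *: X ^+ k).
Proof. by apply: eq_fps_sum => k; rewrite exprZn scalerA mulrC. Qed.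

(** Pairs of exponents are grouped by their sum [n]. The case [Y = 1] gives the addition law of
    exponentials, the case of opposite coefficients gives conjugation. *)
Lemma fps_exp_sandwich c d X Y : vanish 1 X ->
  fps_exp (c *: X) * Y * fps_exp (d *: X) =
  fps_sum (fun n => (n`!%:R)^-1 *:
     \sum_(i < n.+1) ('C(n, i)%:R * c ^+ i * d ^+ (n - i)) *: (X ^+ i * Y * X ^+ (n - i))).
Proof.
move=> vX; have s u := summableX u vX.
rewrite !fps_expZ fps_sumMr // fps_sumM //; last exact: summableMr.
rewrite (@fps_sum_partition _ _ _ _ _ (fun p => p.1 + p.2)%N
           (fun n => [seq (i, n - i)%N | i <- iota 0 n.+1])).
- apply: eq_fps_sum => n; rewrite big_map scaler_sumr.
  rewrite -(big_mkord predT (fun i => _ *: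
    (('C(n, i)%:R * c ^+ i * d ^+ (n - i)) *: (X ^+ i * Y * X ^+ (n - i))))).
  rewrite /index_iota subn0; apply: eq_big_seq => i; rewrite mem_iota ltnS => /andP[_ le_in].
  rewrite -!scalerAl -!scalerAr !scalerA; congr (_ *: _).
  have nz k : k`!%:R != 0 :> R by rewrite pnatr_eq0 -lt0n fact_gt0.
  rewrite -(bin_fact le_in) !natrM !invfM.
  have b0 : 'C(n, i)%:R != 0 :> R by rewrite pnatr_eq0 -lt0n bin_gt0.
  by move: (nz i) (nz (n - i)%N) b0 => ? ? ?; field; apply/and3P.
- by move=> n; rewrite map_inj_uniq ?iota_uniq // => i j [].
- move=> [i j] n; apply/mapP/eqP.
    by case=> k; rewrite mem_iota ltnS => /andP[_ le_kn] [-> ->]; rewrite subnKC.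
  by move=> <-; exists i; [rewrite mem_iota /= ltnS leq_addr | rewrite /= addKn].
exact: (summableM (summableMr (fun=> Y) (s (fun k => c ^+ k / k`!%:R)))
         (s (fun k => d ^+ k / k`!%:R))).
Qed.

Lemma fps_exp0 : fps_exp 0 = 1 :> fps A.
Proof.
rewrite -[0](scale0r (1 : fps A)) fps_expZ.
rewrite (@fps_sum_single _ _ _ 0%N) => [|k k0].
  by rewrite !expr0 fact0 divr1 scale1r.
by rewrite expr0n (negPf k0) mul0r scale0r.
Qed.

Lemma fps_expD c d X : vanish 1 X ->
  fps_exp (c *: X) * fps_exp (d *: X) = fps_exp ((c + d) *: X).
Proof.
move=> vX; rewrite -[X in X * _]mulr1 fps_exp_sandwich // fps_expZ.
apply: eq_fps_sum => n; rewrite [_ / _]mulrC -scalerA; congr (_ *: _).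
rewrite addrC exprDn scaler_suml; apply: eq_bigr => i _.
rewrite mulr1 -exprD subnKC ?leq_ord //; congr (_ *: _).
by rewrite -mulr_natl; ring.
Qed.

Lemma fps_expK c X : vanish 1 X -> fps_exp (c *: X) * fps_exp (- c *: X) = 1.
Proof. by move=> vX; rewrite fps_expD // subrr scale0r fps_exp0. Qed.

Lemma fps_expVK c X : vanish 1 X -> fps_exp (- c *: X) * fps_exp (c *: X) = 1.
Proof. by move=> vX; rewrite fps_expD // addNr scale0r fps_exp0. Qed.

(** Left and right multiplication by [X] commute, so their difference obeys the binomial theorem;
    the induction step is Pascal's rule. *)
Lemma iter_ad n X Y :
  iter n (ad (- X)) Y =
  \sum_(i < n.+1) ('C(n, i)%:R * (-1) ^+ i : R) *: (X ^+ i * Y * X ^+ (n - i)).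
Proof.
elim: n => [|n IH]; first by rewrite big_ord1 /= !expr0 !mulr1 mul1r scale1r.
rewrite iterS IH /ad mulNr mulrN opprK mulr_sumr mulr_suml addrC [RHS]big_ord_recl /=.
under [X in _ = _ + X]eq_bigr => i _.
  rewrite /bump /= add1n binS natrD mulrDl scalerDl subSS; over.
rewrite big_split /= addrA; congr (_ + _); last first.
  rewrite -sumrN; apply: eq_bigr => i _.
  by rewrite exprS mulN1r mulrN scaleNr -scalerAr exprS !mulrA.
transitivity (\sum_(i < n.+2) ('C(n, i)%:R * (-1) ^+ i : R) *: (X ^+ i * Y * X ^+ (n.+1 - i))).
  rewrite [RHS]big_ord_recr /= bin_small // mul0r scale0r addr0.
  apply: eq_bigr => i _; rewrite -scalerAl -!mulrA -exprSr subSn //.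
  by rewrite -ltnS.
rewrite big_ord_recl /= !bin0 !subn0; congr (_ + _).
Qed.

Definition expconj c X Y := fps_exp (- c *: X) * Y * fps_exp (c *: X).

(** Hadamard's formula for e^{-cX} Y e^{cX}: in each degree the sandwich is the binomial sum of
    [iter_ad]. *)
Lemma expconjE c X Y : vanish 1 X ->
  expconj c X Y = fps_sum (fun m => (c ^+ m / m`!%:R) *: iter m (ad (- X)) Y).
Proof.
move=> vX; rewrite /expconj fps_exp_sandwich //; apply: eq_fps_sum => n.
rewrite iter_ad [_ / _]mulrC -scalerA; congr (_ *: _).
rewrite scaler_sumr; apply: eq_bigr => i _; rewrite scalerA; congr (_ *: _).
have -> : c ^+ n = c ^+ i * c ^+ (n - i) by rewrite -exprD subnKC ?leq_ord.
by rewrite [(- c) ^+ _]exprNn; ring.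
Qed.

Lemma expconj1 c X : vanish 1 X -> expconj c X 1 = 1.
Proof. by move=> vX; rewrite /expconj mulr1 fps_expVK. Qed.

Lemma expconjM c X Y Z : vanish 1 X ->
  expconj c X (Y * Z) = expconj c X Y * expconj c X Z.
Proof.
move=> vX; rewrite /expconj !mulrA; congr (_ * _).
by rewrite -!mulrA [fps_exp (c *: X) * (_ * _)]mulrA fps_expK // mul1r.
Qed.

Lemma expconj_prod c X (I : Type) (s : seq I) (F : I -> fps A) : vanish 1 X ->
  expconj c X (\prod_(i <- s) F i) = \prod_(i <- s) expconj c X (F i).
Proof.
move=> vX; apply: (big_morph (expconj c X)) => [Y Z|].
  exact: expconjM.
exact: expconj1.
Qed.

Lemma expconjX c X Y n : vanish 1 X -> expconj c X (Y ^+ n) = expconj c X Y ^+ n.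
Proof.
move=> vX; elim: n => [|n IH]; first by rewrite expconj1.
by rewrite !exprS expconjM // IH.
Qed.

Lemma expconjZ c X (r : R) Y : expconj c X (r *: Y) = r *: expconj c X Y.
Proof. by rewrite /expconj -scalerAr -scalerAl. Qed.

Lemma expconj_fps_sum c X (I : choiceType) (F : I -> fps A) : summable F ->
  expconj c X (fps_sum F) = fps_sum (fun i => expconj c X (F i)).
Proof. by move=> sF; rewrite /expconj fps_sumMl // fps_sumMr //; apply: summableMl. Qed.

(** Conjugation is multiplicative and passes through summable sums, hence commutes with the
    exponential; this is what moves each e^{cX} to the left. *)
Lemma expconj_exp c X Y : vanish 1 X -> vanish 1 Y ->
  fps_exp Y * fps_exp (c *: X) = fps_exp (c *: X) * fps_exp (expconj c X Y).
Proof.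
move=> vX vY.
have e k : expconj c X ((k`!%:R^-1 : R) *: Y ^+ k) = (k`!%:R^-1 : R) *: expconj c X Y ^+ k.
  by rewrite expconjZ expconjX.
have -> : fps_exp (expconj c X Y) = expconj c X (fps_exp Y).
  by rewrite [in RHS]/fps_exp expconj_fps_sum ?(eq_fps_sum e) //; apply: summableX.
by rewrite /expconj !mulrA fps_expK // mul1r.
Qed.

End Exponential.

(** * Word series *)

Fixpoint words (K : eqType) (s : seq K) (n : nat) : seq (seq K) :=
  if n is n'.+1 then [::] :: [seq k :: w | k <- s, w <- words s n'] else [:: [::]].

Lemma mem_words (K : eqType) (s : seq K) n w :
  (w \in words s n) = (size w <= n)%N && all (mem s) w.
Proof.
elim: n w => [|n IH] [|k w] //=; rewrite inE /= ltnS.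
apply/allpairsP/and3P.
  by case=> -[k' w'] [/= ks]; rewrite IH => /andP[sw aw] [-> ->].
by case=> sw ks aw; exists (k, w); rewrite /= IH sw aw.
Qed.

Lemma words_uniq (K : eqType) (s : seq K) n : uniq s -> uniq (words s n).
Proof.
move=> us; elim: n => [|n IH] //=; apply/andP; split; last first.
  by apply: allpairs_uniq => // -[? ?] [? ?] _ _ [-> ->].
by apply/allpairsP => -[[k w] [? ? ?]].
Qed.

Section Convolution.
Variables (R : realType) (K : eqType).
Implicit Types (u v : seq K -> R) (w : seq K).

(* Dual to deconcatenation. *)
Definition conv u v w : R := \sum_(i < (size w).+1) u (take i w) * v (drop i w).

Lemma conv_nil u v : conv u v [::] = u [::] * v [::].
Proof. by rewrite /conv big_ord1. Qed.

Lemma conv_cons u v k w :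
  conv u v (k :: w) = u [::] * v (k :: w) + conv (fun w' => u (k :: w')) v w.
Proof. by rewrite /conv big_ord_recl. Qed.

Lemma eq_conv u u' v v' w :
  (forall w', (size w' <= size w)%N -> u w' = u' w') ->
  (forall w', (size w' <= size w)%N -> v w' = v' w') ->
  conv u v w = conv u' v' w.
Proof.
move=> eu ev; apply: eq_bigr => i _; rewrite eu ?ev // ?size_take_min ?geq_minr //.
by rewrite size_drop leq_subr.
Qed.

Lemma conv_on_nil (c : R) v w : conv (fun w' => if w' is [::] then c else 0) v w = c * v w.
Proof.
case: w => [|k w]; first by rewrite conv_nil.
by rewrite conv_cons /conv big1 ?addr0 // => i _; rewrite mul0r.
Qed.

Definition on_letters (c : K -> R) w : R := if w is [:: k] then c k else 0.

Lemma conv_on_letters (c : K -> R) v w :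
  conv (on_letters c) v w = if w is k :: w' then c k * v w' else 0.
Proof.
case: w => [|k w]; first by rewrite conv_nil mul0r.
rewrite conv_cons mul0r add0r -conv_on_nil; apply: eq_conv => // w' _.
Qed.

Definition nil_one w : R := (w == [::])%:R.

Definition convs (us : seq (seq K -> R)) := foldr conv nil_one us.

(** A non-zero term would cut [w] into non-empty pieces, one for each functional, so there cannot be
    more functionals than letters. *)
Lemma convs_short (us : seq (seq K -> R)) w :
  (forall u, List.In u us -> u [::] = 0) -> (size w < size us)%N -> convs us w = 0.
Proof.
elim: us w => [|u us IH] w //= u0 sw.
have {}IH w' : (size w' < size us)%N -> convs us w' = 0.
  by apply: IH => v vus; apply: u0; right.
rewrite /conv big1 // => -[[|i] lt_i] _; rewrite /=.
  by rewrite take0 u0 ?mul0r //; left.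
rewrite IH ?mulr0 // size_drop; case: w sw lt_i => [|k w] //= sw lt_i.
by rewrite subSS (leq_ltn_trans (leq_subr _ _)).
Qed.

End Convolution.
Arguments nil_one {R K}.

Section WordSeries.
Variables (R : realType) (A : algType R) (K : choiceType) (x : K -> fps A).
Implicit Types (u v : seq K -> R) (w : seq K).

(** The first letter gives the rightmost factor, as in [elem_diff]; products of series therefore
    convolve coefficients in the opposite order. *)
Definition wprod w := \prod_(k <- rev w) x k.

Definition wser u := fps_sum (fun w => u w *: wprod w).

(** Letters without constant term, only finitely many of them contributing in each degree: this
    makes word series over an infinite alphabet meaningful. *)
Definition small := (forall k, vanish 1 (x k)) /\ summable x.

Lemma wprod_cat w1 w2 : wprod (w1 ++ w2) = wprod w2 * wprod w1.
Proof. by rewrite /wprod rev_cat big_cat. Qed.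

Lemma wprod_cons k w : wprod (k :: w) = wprod w * x k.
Proof. by rewrite -cat1s wprod_cat /wprod big_seq1. Qed.

Lemma wprod_nil : wprod [::] = 1. Proof. by rewrite /wprod big_nil. Qed.

Hypothesis x_small : small.

(** Modulo h^(n+1) a word with more than [n] letters vanishes, and so does any word containing a
    letter that itself vanishes to that order. *)
Lemma summable_wprod : summable wprod.
Proof.
case: x_small => x1 sx n; have [s us xs] := sx n.
exists (words s n); first exact: words_uniq.
move=> w; rewrite mem_words negb_and -ltnNge => /orP[lt_n | /allPn[k kw ks]].
  apply: vanish_leq lt_n _; elim: w => [|k w IH] //.
  by rewrite wprod_cons /= -addn1; apply: vanishM.
case/splitPr: kw => w1 w2; rewrite wprod_cat wprod_cons.
exact/vanishMr/vanishMl/xs.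
Qed.

(** One list [T] serves all coefficient functions [u], so identities between word series reduce to
    finite sums over [T]. *)
Lemma wser_trunc n : exists2 T : seq (seq K), uniq T &
  forall u, wser u n = \sum_(w <- T) u w *: wprod w n.
Proof.
have [T uT wT] := summable_wprod n; exists T => // u.
by rewrite /wser (fps_sum_seq uT) // => w /wT w0; rewrite fcoefZ w0 ?scaler0.
Qed.

Lemma summable_wser u : summable (fun w => u w *: wprod w).
Proof. exact/summableZ/summable_wprod. Qed.

Lemma eq_wser u v : u =1 v -> wser u = wser v.
Proof. by move=> /funext ->. Qed.

Lemma wserZ (c : R) u : c *: wser u = wser (fun w => c * u w).
Proof.
rewrite /wser fps_sumZ; last exact: summable_wser.
by apply: eq_fps_sum => w; rewrite scalerA.
Qed.

Lemma wser_sum (I : Type) (s : seq I) (P : pred I) (u : I -> seq K -> R) :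
  \sum_(i <- s | P i) wser (u i) = wser (fun w => \sum_(i <- s | P i) u i w).
Proof.
apply: fpsP => n; have [T uT wT] := wser_trunc n.
rewrite fcoef_sum wT; under eq_bigr => i _ do rewrite wT.
by rewrite exchange_big; apply: eq_bigr => w _; rewrite scaler_suml.
Qed.

Lemma wserD u v : wser u + wser v = wser (fun w => u w + v w).
Proof.
have := wser_sum [:: true; false] xpredT (fun b => if b then u else v).
rewrite !big_cons big_nil addr0 => ->.
by apply: eq_wser => w; rewrite !big_cons big_nil addr0.
Qed.

Lemma wser0 : wser (fun=> 0) = 0.
Proof. by rewrite -[RHS](scale0r (wser (fun=> 0))) wserZ; apply: eq_wser => w; rewrite mul0r. Qed.

Lemma wser_delta w0 : wser (fun w => (w == w0)%:R) = wprod w0.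
Proof.
rewrite /wser (@fps_sum_single _ _ _ w0) ?eqxx ?scale1r // => w /negPf ->.
by rewrite scale0r.
Qed.

Lemma wser_nil_one : wser nil_one = 1.
Proof. by rewrite -wprod_nil -wser_delta. Qed.

(** Pairs of words are grouped by their concatenation; the pairs over a given word are its cuts. *)
Lemma wser_conv u v : wser u * wser v = wser (conv v u).
Proof.
rewrite fps_sumM; [|exact: summable_wser..].
rewrite (@fps_sum_partition _ _ _ _ _ (fun p => p.2 ++ p.1)
  (fun w => [seq (drop i w, take i w) | i <- iota 0 (size w).+1])).
- apply: eq_fps_sum => w; rewrite big_map.
  rewrite /conv -(big_mkord predT (fun i => v (take i w) * u (drop i w))) scaler_suml.
  rewrite /index_iota subn0; apply: eq_bigr => i _.
  rewrite -scalerAl -scalerAr scalerA mulrC; congr (_ *: _).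
  by rewrite -wprod_cat cat_take_drop.
- move=> w; rewrite map_inj_in_uniq ?iota_uniq // => i j.
  rewrite !mem_iota !ltnS => /= iw jw [_ /(congr1 size)].
  by rewrite !size_take_min (minn_idPl iw) (minn_idPl jw).
- move=> [w1 w2] w; apply/mapP/eqP => [[i _ [-> ->]]|<-].
    exact: cat_take_drop.
  exists (size w2); first by rewrite mem_iota /= ltnS size_cat leq_addr.
  by rewrite drop_size_cat ?take_size_cat.
exact: (summableM (summable_wser u) (summable_wser v)).
Qed.

(* Interchange of summations for a locally finite family of functionals. *)
Lemma fps_sum_wser (I : choiceType) (u : I -> seq K -> R) v (s : seq K -> seq I) :
    (forall w, uniq (s w)) -> (forall w i, i \notin s w -> u i w = 0) ->
    (forall w, v w = \sum_(i <- s w) u i w) ->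
  fps_sum (fun i => wser (u i)) = wser v.
Proof.
move=> us u0 vE; apply: fpsP => n; have [T uT wT] := wser_trunc n.
pose S := undup (flatten (map s T)).
have sS w i : w \in T -> i \in s w -> i \in S.
  by move=> wi iw; rewrite mem_undup; apply/flattenP; exists (s w); rewrite ?map_f.
rewrite wT (@fps_sum_seq _ _ _ _ _ S) ?undup_uniq //.
  under eq_bigr => i _ do rewrite wT.
  rewrite exchange_big big_seq [RHS]big_seq; apply: eq_bigr => w Tw.
  rewrite vE -scaler_suml; congr (_ *: _).
  rewrite (bigID (mem (s w))) /= [X in _ + X]big1 ?addr0; last by move=> i /u0.
  rewrite -big_filter; apply/perm_big/uniq_perm; rewrite ?filter_uniq ?undup_uniq //.
  by move=> i; rewrite mem_filter andb_idr // => /sS; apply.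
move=> i iS; rewrite wT big_seq big1 // => w wt.
by rewrite u0 ?scale0r //; apply: contra iS; apply: sS.
Qed.

Lemma wser_letters (c : K -> R) : fps_sum (fun k => c k *: x k) = wser (on_letters c).
Proof.
rewrite -(@fps_sum_wser _ (fun k w => c k * (w == [:: k])%:R) _
            (fun w => if w is [:: k] then [:: k] else [::])).
- by apply: eq_fps_sum => k; rewrite -wserZ wser_delta /wprod big_seq1.
- by move=> [|k []].
- move=> [|k [|k' w]] i; rewrite ?inE ?eqseq_cons ?andbF ?andbT ?mulr0 // => ik.
  by rewrite eq_sym (negPf ik) mulr0.
by move=> [|k [|? ?]]; rewrite ?big_nil // big_seq1 eqxx mulr1.
Qed.

Lemma fps_exp_letter (k : K) :
  fps_exp (x k) = wser (fun w => if all (pred1 k) w then (size w)`!%:R^-1 else 0).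
Proof.
rewrite -(@fps_sum_wser _ (fun n w => n`!%:R^-1 * (w == nseq n k)%:R) _ (fun w => [:: size w])).
- apply: eq_fps_sum => n; rewrite -wserZ wser_delta; congr (_ *: _).
  by elim: n => [|n IH]; rewrite ?wprod_nil // exprSr IH wprod_cons.
- by [].
- move=> w n; rewrite inE => nw; case: eqP => [e|]; rewrite ?mulr0 //.
  by rewrite e size_nseq eqxx in nw.
move=> w; rewrite big_seq1; case: ifPn => [/all_pred1P <-|/all_pred1P/eqP/negPf ->].
  by rewrite eqxx mulr1.
by rewrite mulr0.
Qed.

End WordSeries.

Lemma wprod_convs (R : realType) (A : algType R) (K L : choiceType)
    (x : K -> fps A) (y : L -> fps A) (g : L -> seq K -> R) w :
  small x -> (forall j, y j = wser x (g j)) ->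
  wprod y w = wser x (convs (map g w)).
Proof.
move=> x_small yE; elim: w => [|j w IH]; first by rewrite wprod_nil wser_nil_one.
by rewrite wprod_cons IH yE wser_conv.
Qed.

(** Substitution of word series into a word series. As the [g j] vanish on the empty word, only
    words [l] no longer than [w] contribute to [w], which keeps each coefficient finite. *)
Lemma wser_subst (R : realType) (A : algType R) (K : choiceType) (L : finType)
    (x : K -> fps A) (y : L -> fps A) (g : L -> seq K -> R) (u : seq L -> R) :
  small x -> (forall j, y j = wser x (g j)) -> (forall j, g j [::] = 0) ->
  wser y u = wser x (fun w =>
    \sum_(l <- words (enum L) (size w)) u l * convs (map g l) w).
Proof.
move=> x_small yE g0.
rewrite -(@fps_sum_wser _ _ _ _ x_small _ (fun l w => u l * convs (map g l) w) _
   (fun w => words (enum L) (size w))) //.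
- by apply: eq_fps_sum => l; rewrite (wprod_convs _ x_small yE) wserZ.
- by move=> w; apply/words_uniq/enum_uniq.
move=> w l; rewrite mem_words negb_and => /orP[|/allPn[j _]].
  rewrite -ltnNge => lt_l; rewrite convs_short ?mulr0 ?size_map // => f.
  by elim: l {lt_l} => [|j l IH] //= [<-|/IH].
by rewrite inE mem_enum.
Qed.

(** * Ordered products of exponentials *)

Section OrderedProduct.
Variables (R : realType) (A : algType R) (s : nat).
Implicit Types (l : seq 'I_s) (j : 'I_s).

(** The first [n] indices inside the fixed type ['I_s], so that products over all indices can be
    built by induction on [n]. *)
Definition ord_prefix n : seq 'I_s := pmap insub (iota 0 n).

Lemma ord_prefixS j : ord_prefix j.+1 = rcons (ord_prefix j) j.
Proof.
rewrite /ord_prefix -addn1 iotaD pmap_cat -cats1; congr (_ ++ _).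
by rewrite /= add0n valK.
Qed.

Lemma ord_prefix_enum : ord_prefix s = enum 'I_s.
Proof. by rewrite enumT unlock. Qed.

(** The weight 1/(q_1! ... q_s!) of the decorated sum, extended by 0 to unsorted words: sums over
    decorations become word series. *)
Definition sorted_coef l : R := if dec_sorted l then (dec_mult l)%:R^-1 else 0.

Lemma dec_sorted_cat l j q : all (fun i : 'I_s => i < j)%N l ->
  dec_sorted (l ++ nseq q j) = dec_sorted l.
Proof.
rewrite /dec_sorted map_cat map_nseq => /allP lj; case: l lj => [|i l] lj /=.
  by case: q => //= q; elim: q => //= q ->; rewrite leqnn.
rewrite cat_path andb_idr // => _; case: q => //= q; apply/andP; split.
  by rewrite last_map ltnW // lj // mem_last.
by elim: q => //= q ->; rewrite leqnn.
Qed.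

Lemma dec_mult_cat l j q : all (fun i : 'I_s => i < j)%N l ->
  dec_mult (l ++ nseq q j) = (dec_mult l * q`!)%N.
Proof.
move=> /allP lj; rewrite /dec_mult (bigD1 j) //= [in RHS](bigD1 j) //=.
have -> : count_mem j l = 0%N.
  by apply/count_memPn/negP => /lj; rewrite ltnn.
have -> : count_mem j (l ++ nseq q j) = q.
  rewrite count_cat count_nseq /= eqxx mul1n (_ : count_mem j l = 0%N) //.
  by apply/count_memPn/negP => /lj; rewrite ltnn.
rewrite fact0 mul1n mulnC; congr (_ * _)%N; apply: eq_bigr => i ij.
by rewrite count_cat count_nseq /= eq_sym (negPf ij) mul0n addn0.
Qed.

Lemma dec_sorted_split l j : dec_sorted l -> all (fun i : 'I_s => i <= j)%N l ->
  exists l' q, l = l' ++ nseq q j /\ all (fun i : 'I_s => i < j)%N l'.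
Proof.
elim: l => [|i l IH]; first by exists [::], 0%N.
rewrite /dec_sorted /= => il /andP[ij lj].
have [l' [q [e l'j]]] := IH (path_sorted il) lj.
have [lt_ij | le_ji] := ltnP i j.
  by exists (i :: l'), q; rewrite e /= lt_ij.
have eij : i = j by apply/val_inj/anti_leq; rewrite ij le_ji.
exists [::], (size l).+1; split=> //=; congr (_ :: _) => //.
apply/all_pred1P/allP => k kl; apply/eqP/val_inj/anti_leq.
rewrite (allP lj) //= -eij; move: il; rewrite path_sortedE; last exact: leq_trans.
by case/andP=> /allP /(_ (val k)) + _; apply; apply: map_f.
Qed.

(** Multiplication by e^{y_j} appends copies of [j] to words in smaller letters. A sorted word has
    exactly one cut into letters below [j] and copies of [j], and the multiplicity factorials
    multiply. *)
Lemma sorted_coef_step j l :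
  conv (fun l => if all (fun i : 'I_s => i < j)%N l then sorted_coef l else 0)
       (fun l => if all (pred1 j) l then (size l)`!%:R^-1 else 0) l =
  if all (fun i : 'I_s => i <= j)%N l then sorted_coef l else 0.
Proof.
have [/andP[sl lj] | nsl] := boolP (dec_sorted l && all (fun i : 'I_s => i <= j)%N l).
  rewrite lj /sorted_coef sl; have [l' [q [e l'j]]] := dec_sorted_split sl lj.
  have lt_l' : (size l' < (size l).+1)%N by rewrite ltnS e size_cat leq_addr.
  rewrite /conv (bigD1 (Ordinal lt_l')) //= big1 ?addr0 => [|[i lt_il] i_l' /=].
    rewrite e take_size_cat // drop_size_cat // l'j.
    rewrite all_nseq /= eqxx orbT size_nseq dec_mult_cat //.
    by rewrite -[dec_sorted l'](dec_sorted_cat q l'j) -e sl natrM invfM.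
  case: (ltngtP i (size l')) => [lt_i | gt_i | e_i].
  (* A cut that comes too early leaves a letter below [j] on the right. *)
  - rewrite [X in _ * X]ifN ?mulr0 //; apply/allPn; rewrite e drop_cat lt_i.
    have: (0 < size (drop i l'))%N by rewrite size_drop subn_gt0.
    case E: (drop i l') => [|k w] // _; exists k; first by rewrite mem_head.
    have: k \in l' by rewrite (mem_drop (n0 := i)) // E mem_head.
    by move/(allP l'j); rewrite /= => /ltn_eqF; apply: contraFN => /eqP ->.
  (* A cut that comes too late leaves a copy of [j] on the left. *)
  - rewrite ifN ?mul0r //; apply/allPn; exists j; last by rewrite ltnn.
    rewrite e take_cat ltnNge (ltnW gt_i) /= mem_cat; apply/orP; right.
    rewrite take_nseq; last first.
      by rewrite leq_subLR -(size_nseq q j) -size_cat -e -ltnS.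
    by rewrite mem_nseq eqxx subn_gt0 gt_i.
  by case/eqP: i_l'; apply/val_inj.
rewrite [RHS](_ : _ = 0); last first.
  by case: ifP nsl => // lj; rewrite andbT /sorted_coef => /negPf ->.
rewrite /conv big1 // => i _; case: ifP => // [tj|]; last by rewrite mul0r.
case: ifP => // [dj|]; last by rewrite mulr0.
rewrite /sorted_coef; case: ifP => // [st|]; last by rewrite mul0r.
case/negP: nsl; rewrite -{1 2}[l](cat_take_drop i).
rewrite (all_pred1P _ _ dj) dec_sorted_cat // st all_cat all_nseq leqnn orbT andbT.
by apply: sub_all tj => k /ltnW.
Qed.

Variable y : 'I_s -> fps A.
Hypothesis y_small : forall j, vanish 1 (y j).

Lemma small_ord : small y.
Proof.
split=> // n; exists (enum 'I_s); first exact: enum_uniq.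
by move=> i; rewrite mem_enum.
Qed.

Lemma prod_fps_exp :
  \prod_(j <- rev (enum 'I_s)) fps_exp (y j) = wser y sorted_coef.
Proof.
have step n : (n <= s)%N -> \prod_(j <- rev (ord_prefix n)) fps_exp (y j) =
    wser y (fun l => if all (fun i : 'I_s => i < n)%N l then sorted_coef l else 0).
  elim: n => [|n IH] lt_n.
    rewrite big_nil -(wser_nil_one y); apply: eq_wser => -[|i l] //=.
    rewrite /nil_one eqxx /sorted_coef /dec_sorted /= /dec_mult.
    by rewrite big1 ?invr1.
  rewrite (ord_prefixS (Ordinal lt_n)) rev_rcons big_cons IH ?(ltnW lt_n) //.
  rewrite (fps_exp_letter small_ord) (wser_conv small_ord).
  by apply: eq_wser => l; rewrite (sorted_coef_step (Ordinal lt_n)).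
rewrite -ord_prefix_enum step //; apply: eq_wser => l.
by rewrite (introT allP) // => i _; apply: ltn_ord.
Qed.

End OrderedProduct.

(** * Powers of the time step in iterated commutators *)

Section Generators.
Variables (R : realType) (A : algType R).
Implicit Types (f X Z : fps A).

Lemma fcoef_hM f n : ('h * f) n = if n is n'.+1 then f n' else 0.
Proof.
rewrite fcoefM big_ord_recl /= mul0r add0r; case: n => [|n]; first by rewrite big_ord0.
rewrite big_ord_recl /= mul1r subSS subn0 big1 ?addr0 // => i _.
by rewrite mul0r.
Qed.

Lemma h_comm f : GRing.comm 'h f.
Proof.
apply: fpsP => n; rewrite fcoef_hM [RHS]fps_mul_rev big_ord_recl /= mulr0 add0r.
case: n => [|n]; first by rewrite big_ord0.
rewrite big_ord_recl /= mulr1 subSS subn0 big1 ?addr0 // => i _.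
by rewrite mulr0.
Qed.

Lemma vanish_h f : vanish 1 ('h * f).
Proof. by case=> // _; rewrite fcoef_hM. Qed.

Lemma hXM_prod (I : Type) (r : seq I) (d : I -> nat) (F : I -> fps A) :
  \prod_(i <- r) ('h ^+ d i * F i) = 'h ^+ (\sum_(i <- r) d i)%N * \prod_(i <- r) F i.
Proof.
elim: r => [|i r IH]; first by rewrite !big_nil mulr1.
rewrite !big_cons IH exprD -!mulrA; congr (_ * _); rewrite !mulrA.
by congr (_ * _); exact: commrX (commr_sym (h_comm _)).
Qed.

(** Each commutator releases one factor h and the innermost term another; this is where the weight m
    + 1 of an entry m comes from. *)
Lemma iter_ad_h f Z m :
  iter m (ad (- ('h * f))) ('h * Z) = 'h ^+ m.+1 * iter m (ad (- f)) Z.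
Proof.
rewrite -mulrN; move: (- f) => g; elim: m => [|m IH] //; rewrite !iterS IH /ad.
rewrite mulrBr !mulrA; congr (_ * _ - _ * _).
  by rewrite -mulrA (commrX _ (commr_sym (h_comm g))) mulrA -exprS.
by rewrite -mulrA -h_comm mulrA -exprSr.
Qed.

Lemma vanish_iter_ad X Z m : vanish 1 X -> vanish 1 Z ->
  vanish m.+1 (iter m (ad (- X)) Z).
Proof.
move=> vX vZ; elim: m => [|m IH] //; rewrite iterS => k lt_k.
rewrite /ad mulNr mulrN opprK fcoefD -scaleN1r fcoefZ.
rewrite (vanishM vX IH) ?add1n // scaler0 add0r.
by rewrite (vanishM IH vX) ?addn1.
Qed.

End Generators.

(** * The decorated expansion *)

Lemma split_node_prefix (R : realType) s (a : 'I_s -> R) (j : 'I_s) :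
  split_node a j = \sum_(i <- ord_prefix s j.+1) a i.
Proof.
rewrite /split_node -big_filter -[RHS]big_filter; apply/perm_big/uniq_perm.
- by rewrite filter_uniq // index_enum_uniq.
- by rewrite filter_uniq // pmap_sub_uniq // iota_uniq.
by move=> i; rewrite !mem_filter mem_index_enum andbT mem_pmap_sub mem_iota.
Qed.

Section Factorization.
Variables (R : realType) (A : algType R) (s : nat) (a b : 'I_s -> R) (opA : A).
Variable opB : 'I_s -> fps A.
Let X : fps A := 'h * fpsC opA.

(** The element y_j: b_j h B_j after the exponentials of hA standing to its right have been moved to
    its left. *)
Definition split_exponent (j : 'I_s) : fps A :=
  expconj (split_node a j) X (b j *: ('h * opB j)).

Lemma split_exponentE j : split_exponent j =
  fps_sum (fun m => (b j * (split_node a j ^+ m / m`!%:R)) *: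
                    iter m (ad (- X)) ('h * opB j)).
Proof.
have vX : vanish 1 X by apply: vanish_h.
rewrite /split_exponent expconjZ expconjE // fps_sumZ.
  by apply: eq_fps_sum => m; rewrite scalerA.
apply: summableZ => n; exists (iota 0 n.+1); first exact: iota_uniq.
move=> m; rewrite mem_iota /= add0n -leqNgt => le_nm.
exact/(vanish_leq (leqW le_nm))/vanish_iter_ad/vanish_h.
Qed.

Lemma split_exponent_small j : vanish 1 (split_exponent j).
Proof. exact/vanishMr/vanishMl/vanishZ/vanish_h. Qed.

Lemma split_methodE : \sum_(j < s) a j = 1 ->
  split_method a b opA opB = fps_exp X * wser split_exponent (@sorted_coef R s).
Proof.
move=> a1; have vX : vanish 1 X by apply: vanish_h.
rewrite -prod_fps_exp; last exact: split_exponent_small.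
(* After [n] stages all exponentials of [X] are gathered on the left; for n = s their coefficients
   sum to 1. *)
have step n : (n <= s)%N ->
    \prod_(j <- rev (ord_prefix s n))
       (fps_exp (b j *: ('h * opB j)) * fps_exp (a j *: ('h * fpsC opA))) =
    fps_exp ((\sum_(j <- ord_prefix s n) a j) *: X) *
    \prod_(j <- rev (ord_prefix s n)) fps_exp (split_exponent j).
  elim: n => [|n IH] lt_n; first by rewrite !big_nil scale0r fps_exp0 mulr1.
  have e := split_node_prefix a (Ordinal lt_n).
  rewrite -e [ord_prefix s n.+1](ord_prefixS (Ordinal lt_n)) rev_rcons !big_cons.
  rewrite IH ?(ltnW lt_n) // mulrA -[X in X * _]mulrA fps_expD //.
  (* The node includes a_j itself, since e^{a_j X} stands to the right of the exponential of b_j h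
     B_j. *)
  have -> : a (Ordinal lt_n) + \sum_(j <- ord_prefix s n) a j = split_node a (Ordinal lt_n).
    by rewrite e (ord_prefixS (Ordinal lt_n)) -cats1 big_cat big_seq1 addrC.
  by rewrite expconj_exp ?mulrA //; apply/vanishZ/vanish_h.
rewrite /split_method -ord_prefix_enum step // ord_prefix_enum big_enum a1.
by rewrite scale1r.
Qed.

End Factorization.

(** The bound [n] may exceed [k], so that one list of words serves all the lengths occurring in the
    coproduct of a multi-index. *)
Lemma dec_sum_words (R : realType) (V : lmodType R) (s k n : nat)
    (f : seq 'I_s -> V) : (k <= n)%N ->
  dec_sum k f = \sum_(l <- words (enum 'I_s) n | size l == k) sorted_coef R l *: f l.
Proof.
move=> le_kn; rewrite /dec_sum.
transitivity (\sum_(t : k.-tuple 'I_s) sorted_coef R t *: f t).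
  rewrite big_mkcond; apply: eq_bigr => t _; rewrite /sorted_coef.
  by case: ifP => // _; rewrite scale0r.
rewrite -(big_map (@tval k 'I_s) predT (fun l => sorted_coef R l *: f l)).
rewrite -[RHS]big_filter; apply/perm_big/uniq_perm.
- by rewrite map_inj_uniq ?index_enum_uniq //; apply: val_inj.
- exact/filter_uniq/words_uniq/enum_uniq.
move=> l; rewrite mem_filter mem_words; apply/mapP/andP.
  case=> t _ ->; rewrite size_tuple eqxx le_kn; split=> //=.
  by apply/allP => i _; rewrite inE mem_enum.
by case=> e _; exists (Tuple e); rewrite ?mem_index_enum.
Qed.

Section Decorated.
Variables (R : realType) (A : algType R) (s : nat) (a b : 'I_s -> R) (opA : A).
Variable opB : 'I_s -> fps A.
Let X : fps A := 'h * fpsC opA.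

Definition dec_gen (k : nat * 'I_s) : fps A := iter k.1 (ad (- X)) ('h * opB k.2).

Lemma dec_gen_small : small dec_gen.
Proof.
have v k : vanish k.1.+1 (dec_gen k) by apply: vanish_iter_ad; apply: vanish_h.
split=> [k|n]; first exact: (vanish_leq _ (v k)).
exists [seq (m, j) | m <- iota 0 n.+1, j <- enum 'I_s].
  by apply: allpairs_uniq; rewrite ?iota_uniq ?enum_uniq // => -[? ?] [? ?] _ _ [-> ->].
move=> [m j] mj; apply: vanish_leq (v _); rewrite ltnS /= ltnW // ltnNge.
apply: contra mj => le_mn; apply/allpairsP; exists (m, j); split; rewrite ?mem_enum //.
by rewrite mem_iota add0n ltnS.
Qed.

Lemma weight_sum (mu : mindex) : weight mu = (\sum_(m <- mu) m.+1)%N.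
Proof.
elim: mu => [|m mu IH]; first by rewrite big_nil.
by rewrite big_cons -IH /weight /= addnCA !addSn addnS.
Qed.

Lemma dec_elem_diffE mu (lam : seq 'I_s) : size mu = size lam ->
  dec_elem_diff opA opB mu lam = wprod dec_gen (zip mu lam).
Proof.
move=> e; rewrite /dec_elem_diff /wprod.
under [RHS]eq_bigr => k _ do rewrite /dec_gen iter_ad_h.
rewrite hXM_prod; congr ('h ^+ _ * _).
rewrite weight_sum -{1}[mu](@unzip1_zip _ _ mu lam) ?e // big_map.
by apply: perm_big; rewrite perm_sym perm_rev.
Qed.

Definition letter_coef (j : 'I_s) (k : nat * 'I_s) : R :=
  if k.2 == j then b j * (split_node a j ^+ k.1 / k.1`!%:R) else 0.

Lemma split_exponent_letters j :
  split_exponent a b opA opB j = wser dec_gen (on_letters (letter_coef j)).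
Proof.
rewrite split_exponentE -(wser_letters dec_gen_small).
rewrite (@fps_sum_partition _ _ _ _ _ fst (fun m => [seq (m, i) | i <- enum 'I_s])).
- apply: eq_fps_sum => m; rewrite big_map big_enum (bigD1 j) //= big1 ?addr0.
    by rewrite /letter_coef eqxx.
  by move=> i /negPf ij; rewrite /letter_coef ij scale0r.
- by move=> m; rewrite map_inj_uniq ?enum_uniq // => i i' [].
- move=> [m i] m'; apply/mapP/eqP => [[i' _ [-> _]] //|<-].
  by exists i; rewrite ?mem_enum.
exact/summableZ/dec_gen_small.2.
Qed.

(** Functionals supported on single letters allow only the cut of [w] into letters, so the
    decorations of [w] must spell [l]. *)
Lemma convs_letters (l : seq 'I_s) w :
  convs [seq on_letters (letter_coef j) | j <- l] w =
  if unzip2 w == l then \prod_(k <- w) letter_coef k.2 k else 0.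
Proof.
elim: l w => [|j l IH] w.
  by case: w => [|k w]; rewrite /= /nil_one ?eqxx ?big_nil.
rewrite /= conv_on_letters; case: w => [|k w] //=; rewrite IH eqseq_cons /letter_coef.
have [<-|] := eqVneq k.2 j; last by rewrite mul0r.
by case: ifP; rewrite /= ?mulr0 // big_cons eqxx.
Qed.

Lemma split_coefE mu (lam : seq 'I_s) : size mu = size lam ->
  split_coef a b mu lam / (mfact mu)%:R = \prod_(k <- zip mu lam) letter_coef k.2 k.
Proof.
rewrite /split_coef /mfact.
elim: mu lam => [|m mu IH] [|j lam] //= => [_|[/IH {}IH]].
  by rewrite !big_nil divr1.
rewrite !big_cons -IH /letter_coef /= eqxx natrM invfM; ring.
Qed.

(** A word in the letters [dec_gen] is a multi-index zipped with a decoration. After substitution,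
    grouping these words by their multi-index gives the decorated series. *)
Lemma wser_dec_mseries :
  wser (split_exponent a b opA opB) (@sorted_coef R s) =
  dec_mseries opA opB (split_coef a b).
Proof.
rewrite (wser_subst _ dec_gen_small split_exponent_letters) //.
rewrite /wser (@fps_sum_partition _ _ _ _ _ (@unzip1 nat 'I_s)
  (fun mu => [seq zip mu l | l <- words (enum 'I_s) (size mu) & size l == size mu])).
- apply: eq_fps_sum => mu; rewrite (dec_sum_words _ (leqnn _)).
  rewrite big_map big_filter; apply: eq_bigr => l /eqP e.
  rewrite -dec_elem_diffE // split_coefE // scalerA; congr (_ *: _).
  rewrite size2_zip ?e // (bigD1_seq l) /=; first last.
  + exact/words_uniq/enum_uniq.
  + by rewrite mem_words e leqnn; apply/allP => i _; rewrite inE mem_enum.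
  rewrite convs_letters unzip2_zip ?e // eqxx [X in _ + X]big1 ?addr0 // => l' l'l.
  by rewrite convs_letters unzip2_zip ?e // eq_sym (negPf l'l) mulr0.
- move=> mu; rewrite map_inj_in_uniq; first exact/filter_uniq/words_uniq/enum_uniq.
  move=> l l'; rewrite !mem_filter => /andP[/eqP e _] /andP[/eqP e' _] /(congr1 unzip2).
  by rewrite !unzip2_zip ?e ?e'.
- move=> w mu; apply/mapP/eqP => [[l]|<-].
    by rewrite mem_filter => /andP[/eqP e _] ->; rewrite unzip1_zip ?e.
  exists (unzip2 w); last by rewrite zip_unzip.
  rewrite mem_filter mem_words !size_map eqxx leqnn /=.
  by apply/allP => i _; rewrite inE mem_enum.
exact/summable_wser/dec_gen_small.
Qed.

End Decorated.

(** * The coproduct and convolution *)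

Lemma mem_below mu p : (p \in below mu) = all2 leq p mu.
Proof.
elim: mu p => [|m mu IH] [|q p] //.
  by apply/negP => /allpairsP[? [? ?]].
rewrite /= -IH -ltnS; apply/allpairsP/andP.
  by case=> -[q' p'] [/=]; rewrite -[0 :: _]/(iota 0 m.+1) mem_iota => ? ? [-> ->].
case=> qm pmu; exists (q, p); split=> //=.
by rewrite -[0 :: _]/(iota 0 m.+1) mem_iota.
Qed.

Lemma below_uniq mu : uniq (below mu).
Proof.
elim: mu => [|m mu IH] //; apply: allpairs_uniq; rewrite ?iota_uniq //.
by move=> [? ?] [? ?] _ _ [-> ->].
Qed.

Lemma all2_leq_mdiff mu p : size mu = size p -> all2 leq (mdiff mu p) mu.
Proof. by elim: mu p => [|m mu IH] [|q p] //= [/IH ->]; rewrite leq_subr. Qed.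

Lemma mdiffK mu p : all2 leq p mu -> mdiff mu (mdiff mu p) = p.
Proof.
elim: mu p => [|m mu IH] [|q p] //= /andP[le_qm /IH e].
by rewrite /mdiff /= subKn //; congr (_ :: _).
Qed.

Lemma all2_size (T U : Type) (r : T -> U -> bool) s t : all2 r s t -> size s = size t.
Proof. by elim: s t => [|x s IH] [|y t] //= /andP[_ /IH ->]. Qed.

Section Substitution.
Variables (R : realType).
Implicit Types (mu nu p : mindex).

Lemma mfact_neq0 mu : (mfact mu)%:R != 0 :> R.
Proof.
rewrite pnatr_eq0 -lt0n /mfact; elim: mu => [|m mu IH]; first by rewrite big_nil.
by rewrite big_cons muln_gt0 fact_gt0.
Qed.

Lemma mfact_cat mu nu : mfact (mu ++ nu) = (mfact mu * mfact nu)%N.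
Proof. by rewrite /mfact big_cat. Qed.

Lemma mfact_cons m mu : mfact (m :: mu) = (m`! * mfact mu)%N.
Proof. by rewrite /mfact big_cons. Qed.

Lemma mbinom_mfact mu p : all2 leq p mu ->
  (mbinom mu p * (mfact p * mfact (mdiff mu p)) = mfact mu)%N.
Proof.
elim: mu p => [|m mu IH] [|q p] //=; first by rewrite /mbinom /mfact !big_nil.
case/andP=> le_qm /IH e; rewrite /mbinom /= big_cons -/(mbinom mu p).
by rewrite /mdiff /= -/(mdiff mu p) !mfact_cons -e -(bin_fact le_qm); ring.
Qed.

Definition over_fact (alpha : mindex -> R) mu : R := alpha mu / (mfact mu)%:R.

(** The factorial of a multi-index is multiplicative under concatenation, so dividing by it commutes
    with convolution. *)
Lemma conv_over_fact u v : conv (over_fact u) (over_fact v) =1 over_fact (conv u v).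
Proof.
move=> w; rewrite /over_fact /conv mulr_suml; apply: eq_bigr => i _.
have -> : mfact w = (mfact (take i w) * mfact (drop i w))%N.
  by rewrite -mfact_cat cat_take_drop.
by rewrite natrM invfM; ring.
Qed.

Lemma convs_over_fact (us : seq (mindex -> R)) :
  convs (map over_fact us) =1 over_fact (convs us).
Proof.
elim: us => [|u us IH] w /=.
  rewrite /over_fact /nil_one; case: eqP => [->|_]; last by rewrite mul0r.
  by rewrite /mfact big_nil divr1.
by rewrite (funext IH) conv_over_fact.
Qed.

(** A mismatch in number gives 0, so that a sum over all splittings keeps only those with the right
    number of blocks. *)
Fixpoint blocks (us : seq (mindex -> R)) (pi : seq mindex) : R :=
  match us, pi with
  | [::], [::] => 1
  | u :: us', w :: pi' => u w * blocks us' pi'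
  | _, _ => 0
  end.

Lemma convs_splittings (us : seq (mindex -> R)) mu :
  (forall u, List.In u us -> u [::] = 0) ->
  convs us mu = \sum_(pi <- splittings mu) blocks us pi.
Proof.
elim: mu us => [|m mu IH] [|u us] u0.
- by rewrite /= big_seq1.
- by rewrite /= big_seq1 conv_nil u0 ?mul0r //; left.
- rewrite /= /nil_one big_cat !big_map /= big1 // big1_seq ?addr0 // => pi.
rewrite /= conv_cons u0 ?mul0r ?add0r; last by left.
have us0 v : List.In v us -> v [::] = 0 by move=> vus; apply: u0; right.
(* The first block is [[:: m]] or longer, as in the recursion of [splittings]. Setting [u'] to 0 on
   the empty word separates the two cases and keeps the induction hypothesis applicable. *)
pose u' w := if w == [::] then 0 else u (m :: w).
have -> : conv (fun w => u (m :: w)) (convs us) mu =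
    u [:: m] * convs us mu + conv u' (convs us) mu.
  rewrite -conv_on_nil /conv -big_split; apply: eq_bigr => i _ /=.
  rewrite -mulrDl /u'; congr (_ * _).
  by case: (take i mu) => [|k w] /=; rewrite ?addr0 ?add0r.
rewrite -[conv u' _ _]/(convs (u' :: us) mu) !IH //; last by move=> v [<-|/us0].
rewrite big_cat !big_map mulr_sumr big_filter; congr (_ + _).
rewrite [RHS]big_mkcond big_seq [RHS]big_seq; apply: eq_bigr => -[|w pi] //=.
by rewrite mem_splittings /= => /and3P[_ w0 _]; rewrite /u' (negPf w0).
Qed.

Variables (s : nat) (a b : 'I_s -> R) (beta : 'I_s -> mindex -> R).

(** The coefficients of y_j as a multi-index series, before division by mu!: conjugation raises
    entries by [p], which produces the binomial factors of the coproduct. *)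
Definition conj_char (j : 'I_s) mu : R :=
  b j * \sum_(p <- below mu)
    (mbinom mu p)%:R * split_node a j ^+ sumn p * beta j (mdiff mu p).

Definition block_term (l : seq 'I_s) (pi p : seq mindex) : R :=
  (\prod_(x <- zip pi p) mbinom x.1 x.2)%:R *
  (dec_tensor beta l [seq mdiff x.1 x.2 | x <- zip pi p] *
   split_coef a b (map sumn p) l).

(** The product of the sums over the p_i is expanded; the powers of the nodes, whose exponents are
    the sums of the p_i, are those of [split_coef]. *)
Lemma blocks_conj_char (l : seq 'I_s) (pi : seq mindex) : size l = size pi ->
  blocks (map conj_char l) pi =
  \sum_(p <- cartesian (map below pi)) block_term l pi p.
Proof.
elim: l pi => [|j l IH] [|w pi] //= => [_|[/IH {}IH]].
  by rewrite big_seq1 /block_term /dec_tensor /split_coef !big_nil !mulr1.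
rewrite IH big_allpairs_dep /conj_char mulr_sumr big_distrlr.
apply: eq_bigr => q _; apply: eq_bigr => p _.
rewrite /block_term /dec_tensor /split_coef /= !big_cons /= natrM; ring.
Qed.

Lemma size_cartesian (T : eqType) (ss : seq (seq T)) t :
  t \in cartesian ss -> size t = size ss.
Proof.
elim: ss t => [|r ss IH] t /=; first by rewrite inE => /eqP ->.
by case/allpairsP => -[x t'] [_ /IH /= <- ->].
Qed.

Lemma size_splittings mu pi : pi \in splittings mu -> (size pi <= size mu)%N.
Proof.
rewrite mem_splittings => /andP[/eqP <-]; elim: pi => [|[|m w] pi IH] //= /IH le_pi.
by rewrite ltnS size_cat (leq_trans le_pi) // leq_addl.
Qed.

Lemma mstarE mu : (forall j, beta j [::] = 0) ->
  mstar beta (split_coef a b) mu =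
  \sum_(l <- words (enum 'I_s) (size mu))
     sorted_coef R l * convs (map conj_char l) mu.
Proof.
move=> beta0; rewrite /mstar /coprod big_allpairs_dep.
have g0 (l : seq 'I_s) u : List.In u (map conj_char l) -> u [::] = 0.
  elim: l => [|j l IH] //= [<-|/IH] //.
  by rewrite /conj_char big_seq1 beta0 mulr0 mulr0.
under [RHS]eq_bigr => l _ do rewrite (convs_splittings _ (@g0 l)) mulr_sumr.
rewrite exchange_big big_seq [RHS]big_seq; apply: eq_bigr => pi pimu.
transitivity (\sum_(p <- cartesian (map below pi))
   \sum_(l <- words (enum 'I_s) (size mu) | size l == size pi)
      sorted_coef R l * block_term l pi p).
  rewrite big_seq [RHS]big_seq; apply: eq_bigr => p /size_cartesian /=.
  rewrite !size_map => sp; rewrite sp (dec_sum_words _ (size_splittings pimu)).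
  by rewrite mulr_sumr; apply: eq_bigr => l _; rewrite /block_term mulrCA.
rewrite exchange_big [RHS](bigID (fun l => size l == size pi)) /=.
(* Words whose length is not the number of blocks contribute 0, because [blocks] does. *)
rewrite [X in _ = _ + X]big1 ?addr0 => [|l].
  by apply: eq_bigr => l /eqP e; rewrite -mulr_sumr blocks_conj_char.
move=> nl; rewrite (_ : blocks _ _ = 0) ?mulr0 //.
elim: l pi nl {pimu} => [|j l IH] [|w pi] //= /IH ->.
by rewrite mulr0.
Qed.

End Substitution.

(** * Multi-index series *)

Section MultiIndexSeries.
Variables (R : realType) (A : algType R) (opA opB : A).
Let X : fps A := 'h * fpsC opA.

Definition ad_gen (m : nat) : fps A := iter m (ad (- X)) ('h * fpsC opB).

Lemma ad_gen_small : small ad_gen.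
Proof.
have v m : vanish m.+1 (ad_gen m) by apply: vanish_iter_ad; apply: vanish_h.
split=> [m|n]; first exact: (vanish_leq _ (v m)).
exists (iota 0 n.+1); first exact: iota_uniq.
move=> m; rewrite mem_iota add0n -leqNgt => le_nm.
exact: vanish_leq (leqW le_nm) (v m).
Qed.

Lemma elem_diffE mu : elem_diff opA opB mu = wprod ad_gen mu.
Proof.
rewrite /elem_diff /wprod.
under [RHS]eq_bigr => m _ do rewrite /ad_gen iter_ad_h.
rewrite hXM_prod weight_sum; congr ('h ^+ _ * _).
by apply: perm_big; rewrite perm_sym perm_rev.
Qed.

Lemma mseriesE alpha : mseries opA opB alpha = wser ad_gen (over_fact alpha).
Proof. by apply: eq_fps_sum => mu; rewrite elem_diffE. Qed.

Definition shift_coef (c : R) (m n : nat) : R :=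
  if (m <= n)%N then c ^+ (n - m) / (n - m)`!%:R else 0.

Lemma expconj_ad_gen c m : expconj c X (ad_gen m) = wser ad_gen (on_letters (shift_coef c m)).
Proof.
have vX : vanish 1 X by apply: vanish_h.
rewrite expconjE // -(wser_letters ad_gen_small).
rewrite (@fps_sum_partition _ _ _ _ _ (addn m)
   (fun n => if (m <= n)%N then [:: (n - m)%N] else [::])).
- apply: eq_fps_sum => n; rewrite /shift_coef; case: leqP => [le_mn|_].
    by rewrite big_seq1 /ad_gen -iterD subnK.
  by rewrite big_nil scale0r.
- by move=> n; case: ifP.
- move=> i n; case: leqP => [le_mn|lt_nm]; last first.
    by apply/esym/eqP => e; rewrite -e ltnNge leq_addr in lt_nm.
  by rewrite inE -(eqn_add2l m) subnKC.
apply: summableZ => n; exists (iota 0 n.+1); first exact: iota_uniq.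
move=> i; rewrite mem_iota add0n -leqNgt => le_ni.
rewrite /ad_gen -iterD; apply: (@vanish_leq _ _ _ (i + m).+1).
  by rewrite ltnS (leq_trans (ltnW le_ni)) ?leq_addr.
by apply: vanish_iter_ad; apply: vanish_h.
Qed.

Lemma convs_shift c mu nu :
  convs [seq on_letters (shift_coef c m) | m <- mu] nu =
  if all2 leq mu nu then c ^+ sumn (mdiff nu mu) / (mfact (mdiff nu mu))%:R else 0.
Proof.
elim: mu nu => [|m mu IH] [|n nu]; rewrite /= ?conv_on_letters //.
  by rewrite /nil_one /= /mfact big_nil divr1.
rewrite IH /shift_coef; case: leqP => _ /=; last by rewrite mul0r.
case: ifP => _; last by rewrite mulr0.
by rewrite mfact_cons exprD natrM invfM; ring.
Qed.

(** Conjugation acts letter by letter, so nu receives contributions from the words nu \ p; the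
    identity 1/(p! (nu \ p)!) = binom(nu, p)/nu! then gives the coefficients. *)
Lemma expconj_wser c (u : mindex -> R) :
  expconj c X (wser ad_gen (over_fact u)) =
  wser ad_gen (over_fact (fun mu => \sum_(p <- below mu)
    (mbinom mu p)%:R * c ^+ sumn p * u (mdiff mu p))).
Proof.
have vX : vanish 1 X by apply: vanish_h.
rewrite {1}/wser expconj_fps_sum; last exact: summable_wser ad_gen_small _.
rewrite -(@fps_sum_wser _ _ _ _ ad_gen_small _ (fun mu nu => over_fact u mu *
   convs [seq on_letters (shift_coef c m) | m <- mu] nu) _
   (fun nu => [seq mdiff nu p | p <- below nu])).
- apply: eq_fps_sum => mu; rewrite expconjZ -(wserZ ad_gen_small); congr (_ *: _).
  rewrite /wprod expconj_prod //;
  exact: (wprod_convs (y := fun m => expconj c X (ad_gen m)) mu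
    ad_gen_small (expconj_ad_gen c)).
- move=> nu; rewrite map_inj_in_uniq ?below_uniq // => p q.
  by rewrite !mem_below => /mdiffK + /mdiffK + e; rewrite e => -> ->.
- move=> nu mu; rewrite convs_shift; case: ifP => [le_mu|_]; last by rewrite mulr0.
  case/mapP; exists (mdiff nu mu); last by rewrite mdiffK.
  by rewrite mem_below all2_leq_mdiff // (all2_size le_mu).
move=> nu; rewrite big_map /over_fact mulr_suml big_seq [RHS]big_seq.
apply: eq_bigr => p; rewrite mem_below => le_p.
rewrite convs_shift all2_leq_mdiff; last by rewrite (all2_size le_p).
rewrite mdiffK // -(mbinom_mfact le_p) !natrM.
have := mfact_neq0 R nu; rewrite -(mbinom_mfact le_p) !natrM !mulf_eq0 !negb_or.
by case/and3P => ? ? ?; field; apply/and3P.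
Qed.

End MultiIndexSeries.

(** The ordered product is that of the decorated expansion; only the y_j are now expanded in the
    generators [ad_gen], built from A and B alone. *)
Lemma split_exponent_mseries (R : realType) (A : algType R) (opA opB : A) (s : nat)
    (a b : 'I_s -> R) (op : 'I_s -> fps A) (beta : 'I_s -> mindex -> R) :
  (forall j, 'h * op j = mseries opA opB (beta j)) -> (forall j, beta j [::] = 0) ->
  wser (split_exponent a b opA op) (@sorted_coef R s) =
  mseries opA opB (mstar beta (split_coef a b)).
Proof.
move=> opE beta0.
have yE j : split_exponent a b opA op j =
    wser (ad_gen opA opB) (over_fact (conj_char a b beta j)).
  rewrite /split_exponent expconjZ opE mseriesE expconj_wser (wserZ (ad_gen_small _ _)).
  by apply: eq_wser => mu; rewrite /over_fact mulrA.
rewrite (wser_subst _ (ad_gen_small _ _) yE); last first.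
  by move=> j; rewrite /over_fact /conj_char big_seq1 beta0 !mulr0 mul0r.
rewrite mseriesE; apply: eq_wser => mu; rewrite /over_fact mstarE // mulr_suml.
apply: eq_bigr => l _; rewrite -mulrA; congr (_ * _).
by rewrite -[RHS]/(over_fact _ mu) -convs_over_fact -map_comp.
Qed.

(** * Shuffles and infinitesimal characters *)

Section Shuffles.
Variable R : realType.
Implicit Types (u v alpha : mindex -> R) (mu eta nu : mindex).

Definition shuffle_sum u mu eta : R := \sum_(w <- shuffle mu eta) u w.

Lemma shuffle_sum_nill u eta : shuffle_sum u [::] eta = u eta.
Proof. by case: eta => [|n eta]; rewrite /shuffle_sum big_seq1. Qed.

Lemma shuffle_sum_nilr u mu : shuffle_sum u mu [::] = u mu.
Proof. by case: mu => [|m mu]; rewrite /shuffle_sum big_seq1. Qed.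

Lemma shuffle_sum_cons u m mu n eta : shuffle_sum u (m :: mu) (n :: eta) =
  shuffle_sum (fun w => u (m :: w)) mu (n :: eta) + shuffle_sum (fun w => u (n :: w)) (m :: mu) eta.
Proof. by rewrite /shuffle_sum /= big_cat !big_map. Qed.

Lemma shuffle_sumD u v mu eta :
  shuffle_sum (fun w => u w + v w) mu eta = shuffle_sum u mu eta + shuffle_sum v mu eta.
Proof. exact: big_split. Qed.

Lemma shuffle_sumZ (c : R) u mu eta :
  shuffle_sum (fun w => c * u w) mu eta = c * shuffle_sum u mu eta.
Proof. by rewrite /shuffle_sum mulr_sumr. Qed.

Lemma shuffle_weight mu eta w :
  w \in shuffle mu eta -> weight w = (weight mu + weight eta)%N.
Proof.
elim: mu eta w => [|m mu IHm] eta w; first by case: eta => [|? ?]; rewrite inE => /eqP ->.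
have wc k (z : mindex) : weight (k :: z) = (k.+1 + weight z)%N by rewrite !weight_sum big_cons.
elim: eta w => [|n eta IHn] w; first by rewrite inE => /eqP ->; rewrite addn0.
rewrite /= mem_cat => /orP[] /mapP[w' w'P ->]; rewrite wc.
  by rewrite (IHm _ _ w'P) [in RHS]wc addnA.
by rewrite (IHn _ w'P) [weight (n :: eta)]wc addnCA.
Qed.

Lemma weight_gt0 mu : mu != [::] -> (0 < weight mu)%N.
Proof. by case: mu. Qed.

(** Convolution of functionals of two words, dual to cutting both words independently. *)
Definition conv2 (f g : mindex -> mindex -> R) mu eta : R :=
  \sum_(i < (size mu).+1) \sum_(j < (size eta).+1)
     f (take i mu) (take j eta) * g (drop i mu) (drop j eta).

Lemma conv2_consr f g mu n eta : conv2 f g mu (n :: eta) =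
  \sum_(i < (size mu).+1) f (take i mu) [::] * g (drop i mu) (n :: eta) +
  conv2 (fun w w' => f w (n :: w')) g mu eta.
Proof. by rewrite -big_split; apply: eq_bigr => i _; rewrite big_ord_recl. Qed.

Lemma conv2_consl f g m mu eta : conv2 f g (m :: mu) eta =
  \sum_(j < (size eta).+1) f [::] (take j eta) * g (m :: mu) (drop j eta) +
  conv2 (fun w w' => f (m :: w) w') g mu eta.
Proof. by rewrite /conv2 big_ord_recl. Qed.

Lemma conv2D f f' g mu eta :
  conv2 (fun w w' => f w w' + f' w w') g mu eta = conv2 f g mu eta + conv2 f' g mu eta.
Proof.
rewrite -big_split; apply: eq_bigr => i _; rewrite -big_split.
by apply: eq_bigr => j _; rewrite mulrDl.
Qed.

Lemma eq_conv2 f f' g mu eta : (forall w w', f w w' = f' w w') ->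
  conv2 f g mu eta = conv2 f' g mu eta.
Proof. by move=> ef; apply: eq_bigr => i _; apply: eq_bigr => j _; rewrite ef. Qed.

(* Deconcatenation is a morphism for the shuffle product. *)
Lemma shuffle_sum_conv u v mu eta :
  shuffle_sum (conv u v) mu eta = conv2 (shuffle_sum u) (shuffle_sum v) mu eta.
Proof.
elim: mu u eta => [|m mu IHm] u eta.
  rewrite shuffle_sum_nill /conv2 big_ord1; apply: eq_bigr => j _.
  by rewrite !shuffle_sum_nill.
elim: eta u => [|n eta IHn] u.
  rewrite shuffle_sum_nilr /conv2; apply: eq_bigr => i _.
  by rewrite big_ord1 !shuffle_sum_nilr.
have cc k (w : mindex) : conv u v (k :: w) =
    u [::] * v (k :: w) + conv (fun w' => u (k :: w')) v w by exact: conv_cons.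
rewrite shuffle_sum_cons (funext (cc m)) (funext (cc n)) !shuffle_sumD !shuffle_sumZ.
rewrite IHm IHn addrACA -mulrDr -shuffle_sum_cons.
pose um w := u (m :: w); pose un w := u (n :: w).
have -> : conv2 (shuffle_sum um) (shuffle_sum v) mu (n :: eta) =
    \sum_(i < (size mu).+1) u (m :: take i mu) * shuffle_sum v (drop i mu) (n :: eta) +
    conv2 (fun w w' => shuffle_sum um w (n :: w')) (shuffle_sum v) mu eta.
  by rewrite conv2_consr; congr (_ + _); apply: eq_bigr => i _; rewrite shuffle_sum_nilr.
have -> : conv2 (shuffle_sum un) (shuffle_sum v) (m :: mu) eta =
    \sum_(j < (size eta).+1) u (n :: take j eta) * shuffle_sum v (m :: mu) (drop j eta) +
    conv2 (fun w w' => shuffle_sum un (m :: w) w') (shuffle_sum v) mu eta.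
  by rewrite conv2_consl; congr (_ + _); apply: eq_bigr => j _; rewrite shuffle_sum_nill.
(* The right side is split by whether each of the two cuts is at position 0; the four groups match
   those on the left. *)
rewrite [RHS]conv2_consr [in RHS]big_ord_recl [in RHS]conv2_consl.
rewrite (eq_conv2 _ _ _ (fun w w' => shuffle_sum_cons u m w n w')) conv2D.
rewrite shuffle_sum_nilr -!addrA; congr (_ + _).
under [in RHS]eq_bigr => i _ do rewrite shuffle_sum_nilr.
congr (_ + _); rewrite addrCA; congr (_ + _).
by apply: eq_bigr => j _; rewrite shuffle_sum_nill.
Qed.

Lemma conv_nil_one_l v mu : conv nil_one v mu = v mu.
Proof.
rewrite -[RHS]mul1r -conv_on_nil; apply: eq_conv => // w _.
by case: w.
Qed.

Lemma conv_nil_one_r v mu : conv v nil_one mu = v mu.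
Proof.
elim: mu v => [|m mu IH] v; first by rewrite conv_nil /nil_one eqxx mulr1.
by rewrite conv_cons IH /nil_one /= mulr0 add0r.
Qed.

(** With [nil_one] as counit, infinitesimal characters are the primitive functionals; this form also
    covers empty words. *)
Lemma infinitesimal_shuffle_sum u mu eta : infinitesimal_character u ->
  shuffle_sum u mu eta = u mu * nil_one eta + nil_one mu * u eta.
Proof.
case=> u0 ush; case: mu => [|m mu].
  by rewrite shuffle_sum_nill u0 mul0r add0r /nil_one eqxx mul1r.
case: eta => [|n eta]; first by rewrite shuffle_sum_nilr u0 mulr0 addr0 /nil_one eqxx mulr1.
by rewrite /shuffle_sum ush // /nil_one /= mul0r mulr0 addr0.
Qed.

(** The two primitive expansions are multiplied; the terms in which the counit takes all of one word
    vanish on non-empty words. The result is symmetric in [u] and [v], so it cancels in a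
    commutator. *)
Lemma infinitesimal_conv u v mu eta :
    infinitesimal_character u -> infinitesimal_character v ->
    mu != [::] -> eta != [::] ->
  shuffle_sum (conv u v) mu eta = u mu * v eta + v mu * u eta.
Proof.
move=> iu iv mu0 eta0; rewrite shuffle_sum_conv.
transitivity (conv u v mu * conv nil_one nil_one eta +
  conv u nil_one mu * conv nil_one v eta + (conv nil_one v mu * conv u nil_one eta +
  conv nil_one nil_one mu * conv u v eta)).
  rewrite /conv2 /conv !big_distrlr -!big_split; apply: eq_bigr => i _.
  rewrite -!big_split; apply: eq_bigr => j _ /=.
  rewrite !infinitesimal_shuffle_sum //; ring.
rewrite !conv_nil_one_l !conv_nil_one_r /nil_one (negPf mu0) (negPf eta0).
by rewrite mulr0 mul0r add0r addr0.
Qed.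

Lemma infinitesimal_commutator u v :
  infinitesimal_character u -> infinitesimal_character v ->
  infinitesimal_character (fun mu => conv v u mu - conv u v mu).
Proof.
move=> iu iv; split=> [|mu eta mu0 eta0].
  by rewrite !conv_nil mulrC subrr.
rewrite sumrB -!/(shuffle_sum _ _ _) !infinitesimal_conv //; ring.
Qed.

Lemma infinitesimalD u v :
  infinitesimal_character u -> infinitesimal_character v ->
  infinitesimal_character (fun mu => u mu + v mu).
Proof.
move=> [u0 ush] [v0 vsh]; split=> [|mu eta mu0 eta0]; first by rewrite u0 v0 addr0.
by rewrite big_split /= ush // vsh // addr0.
Qed.

Lemma infinitesimalZ (c : R) u :
  infinitesimal_character u -> infinitesimal_character (fun mu => c * u mu).
Proof.
move=> [u0 ush]; split=> [|mu eta mu0 eta0]; first by rewrite u0 mulr0.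
by rewrite -mulr_sumr ush // mulr0.
Qed.

(* The functional counterpart of the derivation [ad_{-hA}]. *)
Fixpoint wderiv alpha mu : R :=
  if mu is m :: mu' then
    m%:R * alpha (m.-1 :: mu') + wderiv (fun w => alpha (m :: w)) mu'
  else 0.

Lemma derivD u v mu : wderiv (fun w => u w + v w) mu = wderiv u mu + wderiv v mu.
Proof.
elim: mu u v => [|m mu IH] u v /=; first by rewrite addr0.
by rewrite IH mulrDr addrACA.
Qed.

(** Leibniz rule: lowering a letter of a shuffle amounts to lowering a letter of one of the two
    shuffled words. *)
Lemma shuffle_sum_deriv u mu eta : shuffle_sum (wderiv u) mu eta =
  wderiv (fun w => shuffle_sum u w eta) mu + wderiv (fun w => shuffle_sum u mu w) eta.
Proof.
elim: mu u eta => [|m mu IHm] u eta.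
  by rewrite shuffle_sum_nill add0r; congr wderiv; apply: funext => w; rewrite shuffle_sum_nill.
elim: eta u => [|n eta IHn] u.
  by rewrite shuffle_sum_nilr addr0; congr wderiv; apply: funext => w; rewrite shuffle_sum_nilr.
rewrite shuffle_sum_cons [LHS]/= !shuffle_sumD !shuffle_sumZ IHm IHn [RHS]/= !shuffle_sum_cons /=.
under [fun w => shuffle_sum u (m :: w) (n :: eta)]funext => w do rewrite shuffle_sum_cons.
under [fun w => shuffle_sum u (m :: mu) (n :: w)]funext => w do rewrite shuffle_sum_cons.
rewrite !derivD; ring.
Qed.

(** The words from which raising one entry by 1, the effect of ad_{-X}, leads to [nu]. *)
Fixpoint preds nu : seq mindex :=
  if nu is n :: nu' then
    (if n is n'.+1 then [:: n' :: nu'] else [::]) ++ map (cons n) (preds nu')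
  else [::].

Lemma preds_size nu mu : mu \in preds nu -> size mu = size nu.
Proof.
elim: nu mu => [|n nu IH] mu //=; rewrite mem_cat => /orP[|/mapP[w /IH e ->]].
  by case: n => // n; rewrite inE => /eqP ->.
by rewrite /= e.
Qed.

Lemma preds_weight nu mu : mu \in preds nu -> weight nu = (weight mu).+1.
Proof.
rewrite !weight_sum.
elim: nu mu => [|n nu IH] mu //=; rewrite mem_cat => /orP[|/mapP[w /IH e ->]].
  by case: n => // n; rewrite inE => /eqP ->; rewrite !big_cons.
by rewrite !big_cons e addnS.
Qed.

Lemma preds_uniq nu : uniq (preds nu).
Proof.
elim: nu => [|n nu IH] //=; rewrite cat_uniq map_inj_uniq ?IH ?andbT => [|? ? [] //].
case: n => [|n] //=; first by apply/hasPn => w.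
apply/hasPn => _ /mapP[w _ ->]; rewrite inE eqseq_cons negb_and.
by rewrite neq_ltn ltnS leqnn orbT.
Qed.

(** As m/m! = 1/(m-1)!, division by factorials leaves each lowered multi-index with coefficient 1.
    This is the transpose of ad_{-X} x_m = x_{m+1}. *)
Lemma over_fact_deriv alpha nu :
  over_fact (wderiv alpha) nu = \sum_(mu <- preds nu) over_fact alpha mu.
Proof.
elim: nu alpha => [|n nu IH] alpha; first by rewrite /over_fact mul0r big_nil.
rewrite /= big_cat big_map /=.
have -> : \sum_(mu <- preds nu) over_fact alpha (n :: mu) =
    n`!%:R^-1 * over_fact (wderiv (fun w => alpha (n :: w))) nu.
  rewrite IH mulr_sumr; apply: eq_bigr => mu _.
  by rewrite /over_fact mfact_cons natrM invfM; ring.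
rewrite /over_fact mfact_cons natrM invfM mulrDl; congr (_ + _); last by rewrite mulrCA.
case: n => [|n]; first by rewrite big_nil mul0r mul0r.
rewrite big_seq1 mfact_cons factS !natrM /=.
have := mfact_neq0 R nu.
have f0 : n`!%:R != 0 :> R by rewrite pnatr_eq0 -lt0n fact_gt0.
have n0 : n.+1%:R != 0 :> R by rewrite pnatr_eq0.
by move: n.+1%:R n0 f0 => x ? ? ?; field; apply/and3P.
Qed.

Lemma deriv_eq0 alpha nu : (forall mu, mu \in preds nu -> alpha mu = 0) ->
  wderiv alpha nu = 0.
Proof.
move=> a0; have /eqP := over_fact_deriv alpha nu.
rewrite big_seq big1 => [|mu /a0 e]; last by rewrite /over_fact e mul0r.
by rewrite /over_fact mulf_eq0 invr_eq0 (negPf (mfact_neq0 R nu)) orbF => /eqP.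
Qed.

Lemma infinitesimal_deriv u :
  infinitesimal_character u -> infinitesimal_character (wderiv u).
Proof.
case=> u0 ush; split=> // mu eta mu0 eta0; rewrite -/(shuffle_sum _ _ _) shuffle_sum_deriv.
by rewrite !deriv_eq0 ?addr0 // => w /preds_size sw; apply: ush => //;
   rewrite -size_eq0 sw size_eq0.
Qed.

End Shuffles.

(** * Characters of nested commutators *)

Definition is_letterA (t : bracket) : bool := if t is LetterA then true else false.

(* The functional whose series is [h ^ nletters t] times [t]; a letter A, which
   is no multi-index series, gets the junk value 0. *)
Fixpoint bracket_char (R : realType) (t : bracket) : mindex -> R :=
  match t with
  | LetterA => fun=> 0
  | LetterB => fun mu => (mu == [:: 0%N])%:R
  | Bracket t1 t2 => fun mu =>
      conv (bracket_char R t2) (bracket_char R t1) mu -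
      conv (bracket_char R t1) (bracket_char R t2) mu +
      (- (is_letterA t1)%:R * wderiv (bracket_char R t2) mu +
       (is_letterA t2)%:R * wderiv (bracket_char R t1) mu)
  end.

Section BracketChar.
Variable R : realType.
Implicit Types (t : bracket) (mu : mindex).

(** Homogeneity, proved along the recursion. It implies that only finitely many brackets contribute
    to a given multi-index. *)
Lemma bracket_char_weight t mu : weight mu != nletters t -> bracket_char R t mu = 0.
Proof.
have cw (t1 t2 : bracket) (u v : mindex -> R) nu :
    (forall w, weight w != nletters t1 -> u w = 0) ->
    (forall w, weight w != nletters t2 -> v w = 0) ->
    weight nu != (nletters t1 + nletters t2)%N -> conv u v nu = 0.
  move=> uw vw nun; rewrite /conv big1 // => i _.
  have [e1|/uw ->] := eqVneq (weight (take i nu)) (nletters t1); last by rewrite mul0r.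
  have [e2|/vw ->] := eqVneq (weight (drop i nu)) (nletters t2); last by rewrite mulr0.
  case/eqP: nun; rewrite -e1 -e2 -[in LHS](cat_take_drop i nu).
  by rewrite !weight_sum big_cat.
(* The derivation raises the weight by 1, which accounts for the letter A. *)
have dw (u : mindex -> R) n nu : (forall w, weight w != n -> u w = 0) ->
    weight nu != n.+1 -> wderiv u nu = 0.
  by move=> uw nun; apply: deriv_eq0 => w /preds_weight e; apply: uw; rewrite e in nun.
elim: t mu => [|| t1 IH1 t2 IH2] mu //=.
  by case: (mu =P [:: 0%N]) => [->|_]; rewrite ?eqxx.
move=> ne; rewrite (cw t2 t1) 1?addnC // (cw t1 t2) // subrr add0r.
have -> : - (is_letterA t1)%:R * wderiv (bracket_char R t2) mu = 0.
  by case: t1 ne {IH1} => [|| ? ?] /= ne; rewrite ?oppr0 ?mul0r // (dw _ _ _ IH2) ?mulr0.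
case: t2 ne {IH2} => [|| ? ?] /= ne; rewrite ?mul0r ?addr0 // (dw _ _ _ IH1) ?mulr0 ?addr0 //.
by rewrite -addn1.
Qed.

Lemma infinitesimal_bracket_char t : infinitesimal_character (bracket_char R t).
Proof.
elim: t => [|| t1 i1 t2 i2] /=.
- by split=> // mu eta _ _; rewrite big1.
(* A shuffle of two non-empty words has weight at least 2, while [[:: 0%N]] has weight 1. *)
- split=> // mu eta /weight_gt0 mu0 /weight_gt0 eta0; rewrite big_seq big1 // => w.
  move=> /shuffle_weight ew; case: eqP => // e; move: ew mu0 eta0; rewrite e.
  by case: (weight mu) => [|[|?]] //; case: (weight eta).
apply: infinitesimalD; first exact: infinitesimal_commutator.
by apply: infinitesimalD; apply: infinitesimalZ; apply: infinitesimal_deriv.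
Qed.

End BracketChar.

(** * Nested commutators as multi-index series *)

Section BracketSeries.
Variables (R : realType) (A : algType R) (opA opB : A).
Let X : fps A := 'h * fpsC opA.

Lemma ad_fps_sum (I : choiceType) (F : I -> fps A) (Y : fps A) : summable F ->
  ad Y (fps_sum F) = fps_sum (fun i => ad Y (F i)).
Proof.
move=> sF; apply: fpsP => n; have [s us Fs] := sF n.
have adE Z : ad Y Z = Y * Z + (-1 : R) *: (Z * Y) by rewrite /ad scaleN1r.
rewrite (fps_sum_trunc (n := n) us) // => [|i /Fs vF]; last first.
  move=> m lt_m; rewrite adE fcoefD fcoefZ.
  by rewrite (vanishMl _ vF) // (vanishMr _ vF) // scaler0 addr0.
have -> : \sum_(i <- s) ad Y (F i) = ad Y (\sum_(i <- s) F i).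
  by rewrite /ad sumrB mulr_sumr mulr_suml.
have trunc := fun m => fps_sum_trunc (m := m) us Fs.
rewrite !adE !fcoefD !fcoefZ (eq_fcoefM (f' := Y) _ trunc) //.
by rewrite (eq_fcoefM (g' := Y) trunc).
Qed.

Lemma adM (Y Z Z' : fps A) : ad Y (Z * Z') = ad Y Z * Z' + Z * ad Y Z'.
Proof. by rewrite /ad mulrBl mulrBr !mulrA addrA subrK. Qed.

Fixpoint succs (mu : mindex) : seq mindex :=
  if mu is m :: mu' then (m.+1 :: mu') :: map (cons m) (succs mu') else [::].

Lemma ad_wprod mu :
  ad (- X) (wprod (ad_gen opA opB) mu) = \sum_(nu <- succs mu) wprod (ad_gen opA opB) nu.
Proof.
elim: mu => [|m mu IH]; first by rewrite wprod_nil big_nil /ad mulr1 mul1r subrr.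
rewrite /= wprod_cons adM IH big_cons big_map addrC mulr_suml; congr (_ + _).
  by rewrite wprod_cons.
by apply: eq_bigr => nu _; rewrite wprod_cons.
Qed.

(** Raising and lowering one entry are transposes of each other, with multiplicity at most 1. *)
Lemma count_succs mu nu : count_mem nu (succs mu) = (mu \in preds nu).
Proof.
elim: mu nu => [|m mu IH] [|n nu].
- by [].
- by have -> : ([::] \in preds (n :: nu)) = false by apply/negP => /preds_size.
- by rewrite /= count_map; elim: (succs mu).
rewrite /= count_map mem_cat.
have -> : (m :: mu \in [seq n :: i | i <- preds nu]) = (m == n) && (mu \in preds nu).
  apply/mapP/andP => [[w wP [-> ->]] // | [/eqP -> ?]]; by exists mu.
have -> : count (preim (cons m) (pred1 (n :: nu))) (succs mu) =
    ((m == n) && (mu \in preds nu))%N.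
  case: eqP => [->|ne] /=.
    by rewrite -IH; apply: eq_count => w; rewrite /= eqseq_cons eqxx.
  rewrite (eq_count (a2 := pred0)) ?count_pred0 // => w; rewrite /= eqseq_cons.
  by case: eqP ne.
rewrite eqseq_cons; case: n => [|n]; first by [].
rewrite inE eqseq_cons eqSS; case: (eqVneq m n) => [->|_] //=.
by rewrite ltn_eqF // addn0 orbF.
Qed.

Lemma ad_mseries (alpha : mindex -> R) :
  ad (- X) (mseries opA opB alpha) = mseries opA opB (wderiv alpha).
Proof.
have small := ad_gen_small opA opB.
rewrite !mseriesE {1}/wser ad_fps_sum; last exact: summable_wser.
rewrite -(@fps_sum_wser _ _ _ _ small _
  (fun mu nu => over_fact alpha mu * (count_mem nu (succs mu))%:R) _ preds).
- apply: eq_fps_sum => mu; rewrite -(wserZ small).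
  rewrite /ad -scalerAr -scalerAl -scalerBr -/(ad _ _) ad_wprod; congr (_ *: _).
  under eq_bigr => nu _ do rewrite -wser_delta.
  rewrite (wser_sum small); apply: eq_wser => nu.
  rewrite -sum1_count natr_sum [RHS]big_mkcond; apply: eq_bigr => w _.
  by rewrite /= eq_sym; case: (w == nu).
- exact: preds_uniq.
- by move=> nu mu /negPf mun; rewrite count_succs mun mulr0.
move=> nu; rewrite over_fact_deriv big_seq [RHS]big_seq; apply: eq_bigr => mu munu.
by rewrite count_succs munu mulr1.
Qed.

(** The letter A contributes [X], which is carried as a separate summand. Inside a bracket it acts
    through ad_X, which is minus the derivation, and [X, X] = 0, so every proper bracket is a pure
    series. *)
Lemma bracket_series t :
  'h ^+ nletters t * fpsC (bracket_eval opA opB t) =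
  (is_letterA t)%:R *: X + mseries opA opB (bracket_char R t).
Proof.
have small := ad_gen_small opA opB.
elim: t => [|| t1 IH1 t2 IH2] /=.
- rewrite scale1r expr1 mseriesE (@eq_wser _ _ _ _ _ (fun=> 0)) ?(wser0 small) ?addr0 //.
  by move=> mu; rewrite /over_fact mul0r.
- rewrite scale0r add0r expr1 mseriesE (@eq_wser _ _ _ _ _ (fun w => (w == [:: 0%N])%:R)).
    by rewrite wser_delta /wprod big_seq1.
  move=> mu; rewrite /over_fact; case: eqP => [->|_]; last by rewrite mul0r.
  by rewrite /mfact big_seq1 fact0 divr1.
have hX k (f : fps A) : 'h ^+ k * f = f * 'h ^+ k.
  exact: commr_sym (commrX _ (commr_sym (h_comm f))).
transitivity (ad ('h ^+ nletters t1 * fpsC (bracket_eval opA opB t1))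
                 ('h ^+ nletters t2 * fpsC (bracket_eval opA opB t2))).
  have fC (x y : A) : fpsC x * fpsC y = fpsC (x * y).
    apply: fpsP => n; rewrite fcoefM big_ord_recl /= subn0 big1 ?addr0 => [|i _].
      by case: n => [|n]; rewrite ?mulr0.
    by rewrite mul0r.
  have -> : fpsC (ad (bracket_eval opA opB t1) (bracket_eval opA opB t2)) =
      ad (fpsC (bracket_eval opA opB t1)) (fpsC (bracket_eval opA opB t2)).
    by rewrite /ad !fC; apply: fpsP => -[|n] /=; rewrite ?subr0.
  rewrite /ad mulrBr; congr (_ - _).
    by rewrite exprD -!mulrA; congr (_ * _); rewrite !mulrA -hX.
  by rewrite addnC exprD -!mulrA; congr (_ * _); rewrite !mulrA -hX.
rewrite IH1 IH2 scale0r add0r.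
set S1 := mseries _ _ _; set S2 := mseries _ _ _.
have mM (u v : mindex -> R) :
    mseries opA opB u * mseries opA opB v = mseries opA opB (conv v u).
  by rewrite !mseriesE (wser_conv small); apply: eq_wser => w; apply: conv_over_fact.
have lin (u v : mindex -> R) (c d : R) : c *: mseries opA opB u + d *: mseries opA opB v =
    mseries opA opB (fun mu => c * u mu + d * v mu).
  rewrite !mseriesE !(wserZ small) (wserD small); apply: eq_wser => mu.
  by rewrite /over_fact mulrDl !mulrA.
have adDl (f g k : fps A) : ad (f + g) k = ad f k + ad g k.
  by rewrite /ad mulrDl mulrDr opprD addrACA.
have adN (f g : fps A) : ad f g = - ad g f by rewrite /ad opprB.
have adDr (f g k : fps A) : ad k (f + g) = ad k f + ad k g.
  by rewrite adN adDl opprD -!adN.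
have adZl c (f g : fps A) : ad (c *: f) g = c *: ad f g.
  by rewrite /ad -scalerAl -scalerAr scalerBr.
have adZr c (f g : fps A) : ad g (c *: f) = c *: ad g f by rewrite adN adZl -scalerN -adN.
have adXX (f : fps A) : ad f f = 0 by rewrite /ad subrr.
have adX (u : mindex -> R) : ad X (mseries opA opB u) = - mseries opA opB (wderiv u).
  by rewrite -ad_mseries /ad mulNr mulrN opprD !opprK.
transitivity (1 *: mseries opA opB (fun mu =>
    1 * conv (bracket_char R t2) (bracket_char R t1) mu +
    -1 * conv (bracket_char R t1) (bracket_char R t2) mu) +
  1 *: mseries opA opB (fun mu => - (is_letterA t1)%:R * wderiv (bracket_char R t2) mu +
    (is_letterA t2)%:R * wderiv (bracket_char R t1) mu)).
  rewrite -!lin -!mM -/S1 -/S2 !scale1r scaleN1r adDl !adDr !adZl !adZr adXX.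
  rewrite (adN S1 X) !adX !scaler0 add0r opprK scalerN scaleNr -/(ad S1 S2).
  by rewrite addrA [LHS]addrC.
by rewrite lin; congr mseries; apply: funext => mu; rewrite !mul1r mulN1r.
Qed.

End BracketSeries.

(** * Characters of linear combinations of brackets *)

Fixpoint brackets (n : nat) : seq bracket :=
  [:: LetterA; LetterB] ++
  if n is n'.+1 then [seq Bracket t1 t2 | t1 <- brackets n', t2 <- brackets n'] else [::].

Lemma nletters_gt0 t : (0 < nletters t)%N.
Proof. by elim: t => //= t1 IH1 t2 _; rewrite addn_gt0 IH1. Qed.

Lemma mem_brackets n t : (nletters t <= n.+1)%N -> t \in brackets n.
Proof.
elim: n t => [|n IH] [|| t1 t2] //= le_t; rewrite ?inE ?eqxx ?orbT //.
  by have := leq_add (nletters_gt0 t1) (nletters_gt0 t2); rewrite leqNgt ltnS le_t.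
apply/orP; right; apply/orP; right; apply/allpairsP; exists (t1, t2).
have g1 := nletters_gt0 t1; have g2 := nletters_gt0 t2.
split=> //; apply: IH; rewrite -ltnS (leq_trans _ le_t) //.
  by rewrite -addn1 leq_add2l.
by rewrite -add1n leq_add2r.
Qed.

(** The characters of the single brackets are summed with the given coefficients; homogeneity makes
    this sum finite at each multi-index. *)
Lemma commutator_comb_character (R : realType) (A : algType R) (opA opB : A)
    (C : fps A) : commutator_comb opA opB C ->
  exists beta : mindex -> R,
    [/\ infinitesimal_character beta, beta [:: 0%N] = 1
      & 'h * (fpsC opB + C) = mseries opA opB beta].
Proof.
have small := ad_gen_small opA opB.
case=> r ->; pose c t := if (2 <= nletters t)%N then r t else 0.
(* This list contains all brackets with at most [weight mu + 1] letters; by homogeneity the others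
   vanish at [mu]. *)
pose s (mu : mindex) := undup (brackets (weight mu)).
pose gam mu := \sum_(t <- s mu) c t * bracket_char R t mu.
have gam_inf : infinitesimal_character gam.
  split=> [|mu eta mu0 eta0].
    by rewrite /gam big1 // => t _; rewrite (infinitesimal_bracket_char R t).1 mulr0.
  (* All shuffles of [mu] and [eta] have the same weight, so a single list of brackets serves the
     whole shuffle sum. *)
  transitivity (\sum_(t <- undup (brackets (weight mu + weight eta)))
      c t * shuffle_sum (bracket_char R t) mu eta).
    under [RHS]eq_bigr => t _ do rewrite mulr_sumr.
    rewrite exchange_big big_seq [RHS]big_seq; apply: eq_bigr => w /shuffle_weight e.
    by rewrite /gam /s e.
  by rewrite big1 // => t _; rewrite /shuffle_sum (infinitesimal_bracket_char R t).2 ?mulr0.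
exists (fun mu => bracket_char R LetterB mu + gam mu); split.
- exact/infinitesimalD/gam_inf/infinitesimal_bracket_char.
(* [[:: 0%N]] has weight 1, so brackets with two or more letters vanish there. *)
- rewrite /= /gam big1 ?addr0 // => t _; rewrite /c; case: ifP => [t2|_].
    by rewrite bracket_char_weight ?mulr0 // eq_sym gtn_eqF.
  by rewrite mul0r.
have -> : mseries opA opB (fun mu => bracket_char R LetterB mu + gam mu) =
    mseries opA opB (bracket_char R LetterB) + mseries opA opB gam.
  by rewrite !mseriesE (wserD small); apply: eq_wser => mu; rewrite /over_fact mulrDl.
have := bracket_series opA opB LetterB; rewrite /= scale0r add0r expr1 => <-.
rewrite mulrDr; congr (_ + _); rewrite mseriesE.
rewrite -(@fps_sum_wser _ _ _ _ small _
  (fun t mu => c t * over_fact (bracket_char R t) mu) _ s).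
- apply: fpsP => n; rewrite fcoef_hM.
  rewrite (_ : fps_sum _ n = \sum_(t \in [set: bracket])
    (c t *: ('h ^+ nletters t * fpsC (bracket_eval opA opB t))) n); last first.
    apply: eq_fsbigr => t _; congr (fcoef _ n); rewrite -(wserZ small) /c.
    case: ifP => [t2|_]; last by rewrite !scale0r.
    rewrite bracket_series mseriesE; case: t t2 => [|| ? ?] //= _.
    by rewrite scale0r add0r.
  (* The outer factor h shifts degrees by one: it completes the h^(m-1) of [commutator_comb] to the
     h^m of [bracket_series]. *)
  case: n => [|n].
    rewrite fsbig1 // => t _; rewrite fcoefZ -(prednK (nletters_gt0 t)) exprS.
    by rewrite -mulrA fcoef_hM scaler0.
  apply: eq_fsbigr => t _; rewrite /c; case: ifP => _.
    by rewrite -{2}(prednK (nletters_gt0 t)) exprS -mulrA !fcoefZ fcoef_hM.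
  by rewrite scale0r.
- by move=> mu; apply: undup_uniq.
- move=> mu t; rewrite mem_undup => /negP tmu.
  rewrite /over_fact bracket_char_weight ?mul0r ?mulr0 //.
  by apply/negP => /eqP e; apply/tmu/mem_brackets; rewrite -e.
by move=> mu; rewrite /over_fact /gam mulr_suml; apply: eq_bigr => t _; rewrite mulrA.
Qed.

(** Relations between A and B in [alg] may let different coefficients give the same series. The last
    clause therefore covers every admissible [beta], and the second one guarantees that one
    exists. *)
Theorem theorem5p3 (R : realType) (alg : algType R) (A B : alg) (s : nat)
    (a b : 'I_s -> R) (C : 'I_s -> fps alg) :
  \sum_(j < s) a j = 1 ->
  (forall j : 'I_s, commutator_comb A B (C j)) ->
  let Bmod (j : 'I_s) : fps alg := fpsC B + C j in
  let Phi : fps alg := split_method a b A Bmod in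
  let alpha : mindex -> seq 'I_s -> R := split_coef a b in
  [/\ Phi = fps_exp ('h * fpsC A) * dec_mseries A Bmod alpha,
      forall j : 'I_s, exists beta_j : mindex -> R,
        [/\ infinitesimal_character beta_j, beta_j [:: 0%N] = 1
          & 'h * Bmod j = mseries A B beta_j]
    & forall beta : 'I_s -> mindex -> R,
        (forall j : 'I_s,
           [/\ infinitesimal_character (beta j), beta j [:: 0%N] = 1
             & 'h * Bmod j = mseries A B (beta j)]) ->
        Phi = fps_exp ('h * fpsC A) * mseries A B (mstar beta alpha)].
Proof.
move=> a1 Ccomb Bmod Phi alpha.
(* Both expansions start from this factorisation and differ only in the generators in which the y_j
   are written. *)
have PhiE := split_methodE b A Bmod a1; split.
- by rewrite /Phi PhiE wser_dec_mseries.
- by move=> j; apply: commutator_comb_character.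
move=> beta betaP; rewrite /Phi PhiE (@split_exponent_mseries _ _ A B _ a b Bmod beta) //.
  by move=> j; case: (betaP j).
by move=> j; case: (betaP j) => -[].
Qed.
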